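(* Let $p$ be a prime number and let $G$ be a group of order $p^n$, $n\geq 2$, with an abelian subgroup $H$ of order $p^{n-1}$. Choose any $\alpha\in G$ such that $\alpha$ generates $G/H$, i.e. $\alpha\notin H$, $\alpha^p\in H$. Put $H^p=\{h^p : h\in H\}$ and $H(p)=\{h\in H : h^p=1,\ h\notin H^p\}$, and assume that $[h,\alpha]\in H(p)\cup\{1\}$ for every $h\in H(p)$. Assume also that the $p$-th lower central subgroup $G_{(p)}$ is trivial, where $G_{(0)}=G$ and $G_{(i)}=[G,G_{(i-1)}]$ for $i\geq 1$. Then $H$ is a direct product of normal subgroups of $G$, each of which is of one of the following four types: (1) $(C_p)^s$ for some $s\geq 1$, where there exist generators $\alpha_1,\dots,\alpha_s$ of $(C_p)^s$ such that $[\alpha_j,\alpha]=\alpha_{j+1}$ for $1\leq j\leq s-1$ and $\alpha_s\in Z(G)$. (2) $C_{p^a}$ for some $a\geq 1$, where there exists a generator $\beta$ of $C_{p^a}$ such that $[\beta,\alpha]=\beta^{bp^{a-1}}$ for some $b$ with $0\leq b\leq p-1$. (3) $C_{p^{a_1}}\times C_{p^{a_2}}\times\cdots\times C_{p^{a_k}}\times (C_p)^s$ for some $k\geq 1$, $a_i\geq 2$, $s\geq 1$, where there exist generators $\alpha_{1,1},\alpha_{2,1},\dots,\alpha_{k,1}$ of $C_{p^{a_1}}\times\cdots\times C_{p^{a_k}}$ (with $\alpha_{i,1}$ generating the factor $C_{p^{a_i}}$) such that $[\alpha_{i,1},\alpha]=\alpha_{i+1,1}^{p^{a_{i+1}-1}}\in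 Z(G)$ for $i=1,\dots,k-1$, and there exist generators $\alpha_{k,2},\dots,\alpha_{k,s+1}$ of $(C_p)^s$ such that $[\alpha_{k,j},\alpha]=\alpha_{k,j+1}$ for $1\leq j\leq s$ and $\alpha_{k,s+1}\in Z(G)$. (4) $C_{p^{a_1}}\times C_{p^{a_2}}\times\cdots\times C_{p^{a_k}}$ for some $k\geq 2$, $a_i\geq 2$, where for every $i$ with $1\leq i\leq k$ there exists a generator $\alpha_{i,1}$ of the factor $C_{p^{a_i}}$ such that $[\alpha_{i,1},\alpha]=\alpha_{i+1,1}^{p^{a_{i+1}-1}}\in Z(G)$ for $1\leq i\leq k-1$, and $[\alpha_{k,1},\alpha]\in\langle\alpha_{1,1}^{p^{a_1-1}},\dots,\alpha_{k,1}^{p^{a_k-1}}\rangle$.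
   Context: Commutators are $[a,b]=a^{-1}b^{-1}ab$, and $[G,G_{(i-1)}]$ denotes the subgroup generated by commutators of elements of $G$ and elements of $G_{(i-1)}$. $C_m$ denotes the cyclic group of order $m$, $(C_p)^s$ the direct product of $s$ copies of $C_p$, and $Z(G)$ the center of $G$. Each normal subgroup in the decomposition is an internal direct product of the indicated cyclic subgroups (which need not themselves be normal in $G$), and ''generators of $(C_p)^s$'' means $s$ elements of order $p$ forming a basis of it. *)

(* Defs.v *)
From mathcomp Require Import all_boot all_fingroup all_solvable.

Set Implicit Arguments.
Unset Strict Implicit.
Unset Printing Implicit Defensive.

Local Open Scope group_scope.

Section Types.

Variables (gT : finGroupType) (p : nat).
Implicit Types (G H N : {set gT}) (alpha : gT).

(* H^p: the set of p-th powers, not the subgroup it generates. *)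
Definition pth_powers H : {set gT} := [set h ^+ p | h in H].

(* H(p).  It never contains 1, since 1 = 1 ^+ p. *)
Definition nonpower_ptorsion H : {set gT} :=
  [set h in H | (h ^+ p == 1) && (h \notin pth_powers H)].

(* In the predicates below the generators and exponents are functions on nat,
   used only at the 1-based indices of the families they stand for.  An
   internal direct product of cyclic groups with prescribed orders is an
   iterated dprod of the <[x i]> together with the values of #[x i]. *)

(* Type (1). *)
Definition elementary_chain G alpha N : Prop :=
  exists (s : nat) (x : nat -> gT),
  [/\ 1 <= s,
      \big[dprod/1]_(1 <= j < s.+1) <[x j]> = N,
      forall j, 1 <= j <= s -> #[x j] = p,
      forall j, 1 <= j <= s.-1 -> [~ x j, alpha] = x j.+1
    & x s \in 'Z(G)].

(* Type (2). *)
Definition cyclic_block alpha N : Prop :=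
  exists (a : nat) (beta : gT),
  [/\ 1 <= a,
      <[beta]> = N,
      #[beta] = (p ^ a)%N
    & exists2 b : nat, 0 <= b <= p.-1
                     & [~ beta, alpha] = beta ^+ (b * p ^ a.-1)].

(* Type (3).  Here x i is alpha_{i,1} and y j is alpha_{k,j}, so that y 1 is
   x k and the factor (C_p)^s is generated by y 2, ..., y (s+1). *)
Definition mixed_chain G alpha N : Prop :=
  exists (k s : nat) (a : nat -> nat) (x y : nat -> gT),
  [/\ [/\ 1 <= k, 1 <= s & forall i, 1 <= i <= k -> 2 <= a i],
      [/\ (\big[dprod/1]_(1 <= i < k.+1) <[x i]>)
            \x (\big[dprod/1]_(2 <= j < s.+2) <[y j]>) = N,
          forall i, 1 <= i <= k -> #[x i] = (p ^ a i)%N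
        & forall j, 2 <= j <= s.+1 -> #[y j] = p],
      forall i, 1 <= i <= k.-1 ->
        [~ x i, alpha] = x i.+1 ^+ (p ^ (a i.+1).-1)
        /\ x i.+1 ^+ (p ^ (a i.+1).-1) \in 'Z(G)
    & [/\ y 1%N = x k,
          forall j, 1 <= j <= s -> [~ y j, alpha] = y j.+1
        & y s.+1 \in 'Z(G)]].

(* Type (4). *)
Definition cyclic_chain G alpha N : Prop :=
  exists (k : nat) (a : nat -> nat) (x : nat -> gT),
  [/\ 2 <= k /\ (forall i, 1 <= i <= k -> 2 <= a i),
      \big[dprod/1]_(1 <= i < k.+1) <[x i]> = N
        /\ (forall i, 1 <= i <= k -> #[x i] = (p ^ a i)%N),
      forall i, 1 <= i <= k.-1 ->
        [~ x i, alpha] = x i.+1 ^+ (p ^ (a i.+1).-1)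
        /\ x i.+1 ^+ (p ^ (a i.+1).-1) \in 'Z(G)
    & [~ x k, alpha] \in
        << \bigcup_(1 <= i < k.+1) [set x i ^+ (p ^ (a i).-1)] >>].

End Types.

(* Main.v *)
Require Import Defs.
From HB Require Import structures.
From mathcomp Require Import all_boot all_order all_algebra all_fingroup all_solvable zify ring.
From Stdlib Require Import FunctionalExtensionality Classical_Prop.

(** Write H additively and put D h = [h, alpha], an endomorphism of H.  The
hypothesis on lower central subgroups gives D ^ p = 0, and alpha ^ p centralises
H, so (1 + D) ^ p = 1; together these force p D = 0.  For a basis (x_i) of H, with
x_i of order p ^ a_i and w_i = p ^ (a_i - 1) x_i, the map D is thus given by a
matrix d over F_p: D x_i = sum_j d_ij w_j.  Replacing x_i by x_i + x_j with
a_j < a_i adds row j to row i and leaves the columns alone; replacing x_i by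
x_i + p ^ (a_j - a_i) x_j with a_j > a_i affects the columns only; basis elements
of equal order are changed by simultaneous conjugation.  This is a "bunch of
chains" matrix problem.  It is solved by induction on the number of basis
elements: the least nonzero cell (rows of one rank, columns of one rank) is put
in normal form.  An invertible cyclic diagonal block splits off; otherwise the
cell is a partial matching cutting the index set into chains i -> j -> ..., each
chain becomes a single new index, carrying the row of its last element and the
column of its first, and ordering chains with the same end by decreasing length
yields a smaller problem of the same kind.  At the end H is a direct sum of pieces
with basis y_1, ..., y_k, D y_i = w(y_(i+1)), and D y_k in the span of the w(y_j).
The hypothesis on H(p) and the nilpotency of D leave only the patterns
(1)-(4) for the orders of the y_i. *)

Set Implicit Arguments.
Unset Strict Implicit.
Unset Printing Implicit Defensive.

Import GRing.Theory.

Local Open Scope ring_scope.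

(** * Matrices over finite types and admissible operations *)

(** The obstacle is that a reduction step does not return a problem of the same kind: once chains
    are merged, the entries that remain no longer describe [D] on a basis of [H]. The induction
    therefore runs over an arbitrary predicate [Q] on matrices that is stable under the admissible
    operations ([closed]), and the group enters only through the particular predicate [realized].
    The predicate of the remaining problem says that its matrix, completed by the part already in
    normal form, satisfies [Q] ([banded], [merged]); the weight of the proof lies in showing that
    these are closed again. An index carries two ranks because a merged chain takes its row from one
    basis element and its column from another; at the start both ranks are the exponent. No
    eigenvalues are needed over the prime field: an invertible cyclic block stays a companion
    matrix, since its last row is exactly the freedom that type (4) leaves to the last
    commutator. *)

Lemma sum_delta (R : pzRingType) (I : finType) (k : I) (f : I -> R) :
  \sum_i (i == k)%:R * f i = f k.
Proof.
rewrite (bigD1 k) //= eqxx mul1r big1 ?addr0 // => i /negPf->.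
by rewrite mul0r.
Qed.

Section FinMatrix.
Variable F : fieldType.

Definition fmul (I J K : finType) (A : I -> J -> F) (B : J -> K -> F) : I -> K -> F :=
  fun i k => \sum_j A i j * B j k.

Definition fone (I : finType) : I -> I -> F := fun i j => (i == j)%:R.

Lemma funext2 (I J : Type) (A B : I -> J -> F) : A =2 B -> A = B.
Proof.
by move=> AB; apply: functional_extensionality => i;
  apply: functional_extensionality => j.
Qed.

Lemma fmulA (I J K L : finType) (A : I -> J -> F) (B : J -> K -> F) (C : K -> L -> F) :
  fmul A (fmul B C) = fmul (fmul A B) C.
Proof.
apply: funext2 => i l; rewrite /fmul.
under eq_bigr do rewrite big_distrr /=.
rewrite exchange_big; apply: eq_bigr => k _ /=.
by rewrite big_distrl; apply: eq_bigr => j _ /=; rewrite mulrA.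
Qed.

Lemma fmul1l (I J : finType) (A : I -> J -> F) : fmul (@fone I) A = A.
Proof.
apply: funext2 => i j; rewrite /fmul -[RHS](sum_delta i (A ^~ j)).
by apply: eq_bigr => k _; rewrite /fone eq_sym.
Qed.

Lemma fmul1r (I J : finType) (A : I -> J -> F) : fmul A (@fone J) = A.
Proof.
apply: funext2 => i j; rewrite /fmul -[RHS](sum_delta j (A i)).
by apply: eq_bigr => k _; rewrite /fone mulrC.
Qed.

(** A product through a smaller index set has smaller rank. This keeps count of the indices when a
    base change replaces the index type. *)
Lemma fmul_card_le (I J : finType) (A : I -> J -> F) (B : J -> I -> F) :
  fmul A B = @fone I -> (#|I| <= #|J|)%N.
Proof.
move=> AB.
pose A' := \matrix_(i < #|I|, j < #|J|) A (enum_val i) (enum_val j).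
pose B' := \matrix_(j < #|J|, i < #|I|) B (enum_val j) (enum_val i).
apply: (@mulmx1_min F _ _ A' B'); apply/matrixP => i k.
have := congr1 (fun f => f (enum_val i) (enum_val k)) AB.
rewrite /fmul /fone (inj_eq enum_val_inj) !mxE => <-.
rewrite (reindex (@enum_val _ (mem J))) /=; last first.
  by apply: onW_bij; apply: enum_val_bij.
by apply: eq_bigr => j _; rewrite !mxE.
Qed.

Lemma fmul_card (I J : finType) (A : I -> J -> F) (B : J -> I -> F) :
  fmul A B = @fone I -> fmul B A = @fone J -> #|I| = #|J|.
Proof.
by move=> AB BA; apply/eqP; rewrite eqn_leq (fmul_card_le AB) (fmul_card_le BA).
Qed.

Definition blockd (I J I' J' : Type) (A : I -> J -> F) (B : I' -> J' -> F) :
    I + I' -> J + J' -> F := fun x y =>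
  match x, y with
  | inl i, inl j => A i j | inr i, inr j => B i j | _, _ => 0
  end.

Lemma blockd_mul (I J K I' J' K' : finType) (A : I -> J -> F) (B : J -> K -> F)
    (A' : I' -> J' -> F) (B' : J' -> K' -> F) :
  fmul (blockd A A') (blockd B B') = blockd (fmul A B) (fmul A' B').
Proof.
apply: funext2 => -[i|i] [k|k]; rewrite /fmul big_sumType /=.
- by rewrite [X in _ + X]big1 ?addr0 // => j _; rewrite mul0r.
- by rewrite !big1 ?addr0 // => j _; rewrite ?mul0r ?mulr0.
- by rewrite !big1 ?addr0 // => j _; rewrite ?mul0r ?mulr0.
- by rewrite [X in X + _]big1 ?add0r // => j _; rewrite mul0r.
Qed.

Lemma blockd1 (I J : finType) : blockd (@fone I) (@fone J) = @fone (I + J)%type.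
Proof. by apply: funext2 => -[i|i] [k|k]. Qed.

Lemma reindexing (I J : finType) (d : I -> I -> F) (f : J -> I) (g : I -> J) :
  cancel f g -> cancel g f ->
  let P j i := (f j == i)%:R in let P' i j := (g i == j)%:R in
  [/\ fmul P P' = @fone J, fmul P' P = @fone I
    & fmul P d = fmul (fun i j => d (f i) (f j)) P].
Proof.
move=> fK gK P P'.
have dP (K L : finType) (h : K -> L) (u : L -> F) (k : K) :
  \sum_j (h k == j)%:R * u j = u (h k).
  by rewrite -[RHS](sum_delta (h k)); apply: eq_bigr => j _; rewrite eq_sym.
split; apply: funext2 => i j; rewrite /fmul dP ?/P' ?/P ?fK ?gK //.
rewrite -[LHS](sum_delta j) (reindex f) /=; last by exists g => x _.
by apply: eq_bigr => k _; case: eqP => [->|]; rewrite ?mulr1 ?mul1r ?mulr0 ?mul0r.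
Qed.

(* [Q I r c d] says that [d] is one of the matrices to be reduced; [r] and [c] are the
   ranks of its rows and columns, and only a row (column) of smaller rank may be
   added to another one. *)
Definition mxpred := forall I : finType, (I -> nat) -> (I -> nat) -> (I -> I -> F) -> Prop.

(** Block diagonality along the classes of indices, stated between two index types so that a base
    change may also rename indices. *)
Definition compat (I J : Type) (r c : I -> nat) (r' c' : J -> nat) (P : I -> J -> F) :=
  forall i j, P i j != 0 -> r i = r' j /\ c i = c' j.

(** Inside a class, rows and columns belong to the same basis elements and change together
    ([cl_sim]); [cl_class] says that rows and columns have the same classes. Between classes, rows
    and columns move independently. *)
Record closed (Q : mxpred) : Prop := Closed {
  cl_class : forall I r c d, Q I r c d ->
    forall i j, (r i == r j) = (c i == c j);
  cl_row : forall (I : finType) r c d (k l : I) a, Q I r c d -> (r l < r k)%N ->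
    Q I r c (fun i j => d i j + (i == k)%:R * a * d l j);
  cl_col : forall (I : finType) r c d (k l : I) a, Q I r c d -> (c l < c k)%N ->
    Q I r c (fun i j => d i j + (j == k)%:R * a * d i l);
  cl_sim : forall (I J : finType) r c d r' c' e (P : J -> I -> F) P',
    Q I r c d -> fmul P P' = @fone J -> fmul P' P = @fone I ->
    compat r' c' r c P -> compat r c r' c' P' ->
    fmul P d = fmul e P -> Q J r' c' e }.

(** Through transposition, each fact about rows yields the one about columns. *)
Definition trp (Q : mxpred) : mxpred := fun I r c d => Q I c r (fun i j => d j i).

Lemma fmulT (I J K : finType) (A : I -> J -> F) (B : J -> K -> F) :
  (fun k i => fmul A B i k) = fmul (fun k j => B j k) (fun j i => A i j).
Proof. by apply: funext2 => k i; apply: eq_bigr => j _; rewrite mulrC. Qed.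

Lemma foneT (I : finType) : (fun i j => @fone I j i) = @fone I.
Proof. by apply: funext2 => k i; rewrite /fone eq_sym. Qed.

Lemma trp_closed Q : closed Q -> closed (trp Q).
Proof.
case=> Qcl Qr Qc Qs; split.
- by move=> I r c d /Qcl E i j; rewrite E.
- by move=> I r c d k l a Qd lk; apply: Qc.
- by move=> I r c d k l a Qd lk; apply: Qr.
move=> I J r c d r' c' e P P' Qd PP' P'P cP cP' E.
apply: (Qs _ _ _ _ _ _ _ _ (fun j i => P' i j) (fun i j => P j i) Qd).
- by rewrite -fmulT PP' foneT.
- by rewrite -fmulT P'P foneT.
- by move=> j i /cP' [-> ->].
- by move=> i j /cP [-> ->].
rewrite -fmulT -[RHS]fmulT.
have -> // : fmul d P' = fmul P' e.
by rewrite -[RHS]fmul1r -PP' fmulA -(fmulA P' e) -E !fmulA P'P fmul1l.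
Qed.

Section Closed.
Variable Q : mxpred.
Hypothesis Qcl : closed Q.

(** The strict rank condition forces [v l = 0], so row [l] stays fixed while its multiples are added
    to one row after another. *)
Lemma cl_rows (I : finType) r c d (l : I) (v : I -> F) : Q r c d ->
  (forall k, v k != 0 -> (r l < r k)%N) ->
  Q r c (fun i j => d i j + v i * d l j).
Proof.
move=> Qd vr.
have vl : v l = 0 by apply/eqP; apply: contraTT isT => /vr; rewrite ltnn.
pose f (s : seq I) i j := d i j + (i \in s)%:R * v i * d l j.
suff Qf (s : seq I) : uniq s -> Q r c (f s).
  have := Qf _ (enum_uniq I); congr Q; apply: funext2 => i j.
  by rewrite /f mem_enum mul1r.
elim: s => [_|k s IHs /= /andP[ks us]].
  by congr Q: Qd; apply: funext2 => i j; rewrite /f !mul0r addr0.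
have [vk|/vr lk] := eqVneq (v k) 0.
  congr Q: (IHs us); apply: funext2 => i j; rewrite /f inE.
  by case: eqP => //= ->; rewrite vk !mulr0.
have := cl_row Qcl (v k) (IHs us) lk; congr Q; apply: funext2 => i j.
rewrite /f inE vl mulr0 mul0r addr0; case: eqP => /= [->|_].
  by rewrite (negPf ks) !mul1r !mul0r addr0.
by rewrite !mul0r addr0.
Qed.

(** All source rows have rank [s] and all targets a larger rank, so no source is ever altered and
    the successive additions amount to the single product [fmul N d]. *)
Lemma cl_rowblock (I : finType) r c d s (N : I -> I -> F) : Q r c d ->
  (forall i l, N i l != 0 -> r l = s /\ (s < r i)%N) ->
  Q r c (fun i j => d i j + fmul N d i j).
Proof.
move=> Qd rN.
have N0 i l : (r i <= s)%N -> N i l = 0.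
  by move=> ri; apply/eqP; apply: contraTT ri => /rN[_]; rewrite ltnNge.
pose f (u : seq I) i j := d i j + \sum_(l <- u) N i l * d l j.
suff Qf (u : seq I) : Q r c (f u).
  have := Qf (index_enum I); congr Q.
elim: u => [|l u IHu].
  by congr Q: Qd; apply: funext2 => i j; rewrite /f big_nil addr0.
have [rl|/eqP rl] := eqVneq (r l) s; last first.
  congr Q: IHu; apply: funext2 => i j; rewrite /f big_cons.
  have -> : N i l = 0 by apply/eqP; apply/contraT => /rN[].
  by rewrite mul0r add0r.
have := @cl_rows I r c (f u) l (N ^~ l) IHu _.
have <- : f (l :: u) = fun i j => f u i j + N i l * f u l j.
  apply: funext2 => i j; rewrite /f big_cons.
  rewrite [\sum_(l0 <- u) N l l0 * _]big1 ?addr0; first by rewrite addrA addrAC.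
  by move=> k _; rewrite N0 ?mul0r ?rl.
by apply=> k /rN[-> ].
Qed.

Lemma cl_reindex (I J : finType) r c d (f : J -> I) (g : I -> J) :
  cancel f g -> cancel g f -> Q r c d ->
  Q (r \o f) (c \o f) (fun i j => d (f i) (f j)).
Proof.
move=> fK gK Qd; have [PP' P'P E] := reindexing d fK gK.
apply: (cl_sim Qcl Qd PP' P'P) => // i j.
  by case: (f i =P j) => [<-|] //; rewrite eqxx.
by case: (g i =P j) => [<-|]; rewrite /= ?gK // eqxx.
Qed.

End Closed.

Lemma cl_colblock Q (Qcl : closed Q) (I : finType) r c d t (N : I -> I -> F) :
  Q I r c d -> (forall l j, N l j != 0 -> c l = t /\ (t < c j)%N) ->
  Q I r c (fun i j => d i j + fmul d N i j).
Proof.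
move=> Qd cN.
have := @cl_rowblock _ (trp_closed Qcl) I c r (fun i j => d j i) t (fun i j => N j i) Qd.
have -> : (fun i j => d i j + fmul d N i j) =
  fun i j => d i j + fmul (fun i j => N j i) (fun i j => d j i) j i.
  apply: funext2 => i j; congr (_ + _).
  exact: (congr1 (fun h => h j i) (fmulT d N)).
by apply=> i l /cN.
Qed.

(** * Similarity across index types *)

Definition sim (X Y : finType) (f : X -> X -> F) (g : Y -> Y -> F) :=
  exists P P', [/\ fmul P P' = @fone Y, fmul P' P = @fone X & fmul P f = fmul g P].

Lemma sim_refl (X : finType) (f : X -> X -> F) : sim f f.
Proof. by exists (@fone X), (@fone X); rewrite !fmul1l fmul1r. Qed.

Lemma sim_trans (X Y Z : finType) (f : X -> X -> F) (g : Y -> Y -> F) (h : Z -> Z -> F) :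
  sim f g -> sim g h -> sim f h.
Proof.
case=> P [P' [PP' P'P Pf]] [R [R' [RR' R'R Rg]]].
exists (fmul R P), (fmul P' R'); split.
- by rewrite -fmulA (fmulA P) PP' fmul1l.
- by rewrite -fmulA (fmulA R') R'R fmul1l.
by rewrite -fmulA Pf fmulA Rg -fmulA.
Qed.

Lemma sim_blockd (X Y X' Y' : finType) (f : X -> X -> F) (g : Y -> Y -> F)
    (f' : X' -> X' -> F) (g' : Y' -> Y' -> F) :
  sim f g -> sim f' g' -> sim (blockd f f') (blockd g g').
Proof.
case=> P [P' [PP' P'P Pf]] [R [R' [RR' R'R Rf]]].
exists (blockd P R), (blockd P' R'); rewrite !blockd_mul PP' P'P RR' R'R !blockd1.
by rewrite Pf Rf.
Qed.

Lemma sim_reindex (X Y : finType) (d : X -> X -> F) (f : Y -> X) (g : X -> Y) :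
  cancel f g -> cancel g f -> sim d (fun i j => d (f i) (f j)).
Proof. by move=> fK gK; have [*] := reindexing d fK gK; do 2!eexists; split; eassumption. Qed.

Lemma sim_card (X Y : finType) (f : X -> X -> F) (g : Y -> Y -> F) :
  sim f g -> #|X| = #|Y|.
Proof. by case=> P [P' [PP' P'P _]]; apply: fmul_card P'P PP'. Qed.

End FinMatrix.

(** * Merging chains into single indices *)

(* [E] is cut into chains indexed by [K]; chain [k] is [el k 0, ..., el k (m k)]. *)
Definition chain_struct (E K : Type) (hd : E -> K) (dp : E -> nat) (m : K -> nat)
    (el : K -> nat -> E) :=
  [/\ forall x, (dp x <= m (hd x))%N,
      forall x, el (hd x) (dp x) = x
    & forall k q, (q <= m k)%N -> hd (el k q) = k /\ dp (el k q) = q].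

Lemma chain_struct_rev (E K : Type) (hd : E -> K) dp m el :
  chain_struct hd dp m el ->
  chain_struct hd (fun x => m (hd x) - dp x)%N m (fun k q => el k (m k - q)%N).
Proof.
case=> dpm elK hdE; split=> [x|x|k q qm].
- exact: leq_subr.
- by rewrite subKn ?elK.
- by have [-> ->] := hdE k _ (leq_subr q (m k)); rewrite subKn.
Qed.

Section Merge.
Variable F : fieldType.

(** A nilpotent Jordan matrix, with one block for each chain. *)
Definition shift (E K : finType) (hd : E -> K) (dp : E -> nat) : E -> E -> F :=
  fun x y => ((hd x == hd y) && (dp y == (dp x).+1))%:R.

(** The matrix on elements for which a matrix [d] on chains stands: besides the links, its entries
    lead only from the end of a chain to the beginning of a chain. *)
Definition chain_ext (E K : finType) (hd : E -> K) (dp : E -> nat) (m : K -> nat)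
    (d : K -> K -> F) : E -> E -> F := fun x y =>
  shift hd dp x y +
  ((dp x == m (hd x)) && (dp y == 0%N))%:R * d (hd x) (hd y).

Section Chains.
Variables (E K : finType) (hd : E -> K) (dp : E -> nat) (m : K -> nat) (el : K -> nat -> E).
Hypothesis ch : chain_struct hd dp m el.

Lemma eq_el x k q : (q <= m k)%N -> (x == el k q) = (hd x == k) && (dp x == q).
Proof.
case: ch => _ elK hdE /hdE[hk dk]; apply/eqP/andP => [->|[/eqP <- /eqP <-]].
  by rewrite hk dk !eqxx.
by rewrite elK.
Qed.

Lemma chain_ext_end d k y : chain_ext hd dp m d (el k (m k)) y = (dp y == 0%N)%:R * d k (hd y).
Proof.
case: ch => dpm _ hdE; have [hk dk] := hdE k (m k) (leqnn _).
rewrite /chain_ext /shift hk dk eqxx; have := dpm y.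
by case: eqP => [<- /= ?|_ _] /=; rewrite ?add0r //; case: eqP => [?|]; [lia|rewrite add0r].
Qed.

Lemma chain_ext_mid d k q y : (q < m k)%N -> chain_ext hd dp m d (el k q) y = (y == el k q.+1)%:R.
Proof.
move=> qm; have [_ _ hdE] := ch; have [hk dk] := hdE k q (ltnW qm).
by rewrite /chain_ext /shift hk dk eq_el // [k == _]eq_sym (ltn_eqF qm) mul0r addr0.
Qed.

End Chains.

(** An element with a successor has its row in the cell, hence rank [s]; only the row of the last
    element keeps a rank of its own. Columns behave alike, with [t] and the first element. *)
Definition ext_row_rank (E K : finType) (hd : E -> K) (dp : E -> nat) (m : K -> nat)
  s (rho : K -> nat) x := if dp x == m (hd x) then rho (hd x) else s.
Definition ext_col_rank (E K : finType) (hd : E -> K) (dp : E -> nat)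
  t (gam : K -> nat) x := if dp x == 0%N then gam (hd x) else t.

(* Lexicographic order on pairs with [b < w]: increasing in [a], then decreasing in [b]. *)
Definition pack (w : nat) (a b : nat) := (a * w + (w.-1 - b))%N.

Lemma pack_inj w a b a' b' : (b < w)%N -> (b' < w)%N ->
  pack w a b = pack w a' b' -> a = a' /\ b = b'.
Proof.
rewrite /pack => bw bw'; case: (ltngtP a a') => [aa|aa|<-]; last by lia.
  by have := leq_mul aa (leqnn w); rewrite mulSn; lia.
by have := leq_mul aa (leqnn w); rewrite mulSn; lia.
Qed.

Lemma pack_lt w a b a' b' : (b < w)%N -> (b' < w)%N ->
  (pack w a b < pack w a' b')%N = (a < a')%N || (a == a') && (b' < b)%N.
Proof.
rewrite /pack => bw bw'; case: (ltngtP a a') => [aa|aa|<-] /=; last by lia.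
  by have := leq_mul aa (leqnn w); rewrite mulSn; lia.
by have := leq_mul aa (leqnn w); rewrite mulSn; lia.
Qed.

(* The problem left once the cell [(s, t)] is a partial matching: [K] indexes its
   chains and [d] holds the entries still free.  Adding a chain to another with
   end rows of equal rank drags the inner links along, which is harmless only from a
   longer chain to a shorter one. *)
Definition merged (Q : mxpred F) s t w : mxpred F := fun K r c d =>
  exists (E : finType) hd dp m el rho gam,
  [/\ @chain_struct E K hd dp m el,
      [/\ forall k, (m k < w)%N, forall k, r k = pack w (rho k) (m k)
        & forall k, c k = pack w (gam k) (m k)],
      forall k l, (rho k <= s)%N -> (gam l <= t)%N -> d k l = 0
    & Q E (ext_row_rank hd dp m s rho) (ext_col_rank hd dp t gam) (chain_ext hd dp m d)].

(** Transposition reverses each chain, so ends and beginnings change places, and so do [s] and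
    [t]. *)
Lemma merged_trp (Q : mxpred F) s t w (K : finType) r c (d : K -> K -> F) :
  merged Q s t w c r (fun i j => d j i) -> merged (trp Q) t s w r c d.
Proof.
case=> E [hd [dp [m [el [rho [gam [ch [mw rE cE] z Qd]]]]]]].
have [dpm elK hdE] := ch.
exists E, hd, (fun x => m (hd x) - dp x)%N, m, (fun k q => el k (m k - q)%N), gam, rho.
split=> //; first exact: chain_struct_rev.
  by move=> k l gk rl; apply: z.
rewrite /trp; congr (Q E _ _ _): Qd.
- apply: functional_extensionality => x; rewrite /ext_row_rank /ext_col_rank.
  by congr (if _ then _ else _); have := dpm x; lia.
- apply: functional_extensionality => x; rewrite /ext_row_rank /ext_col_rank.
  by congr (if _ then _ else _); have := dpm x; lia.
apply: funext2 => x y; rewrite /chain_ext /shift; have := dpm x; have := dpm y.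
move=> yb xb; rewrite [in RHS]eq_sym.
have -> : (hd x == hd y) && (dp y == (dp x).+1) =
  (hd x == hd y) && (m (hd x) - dp x == (m (hd y) - dp y).+1)%N.
  by case: eqP => //= E0; rewrite -E0 in yb *; lia.
congr (_ + (nat_of_bool _)%:R * _); lia.
Qed.

Lemma bool_mulr (b1 b2 : bool) : b1%:R * b2%:R = (b1 && b2)%:R :> F.
Proof. by rewrite -natrM mulnb. Qed.

(** * Operations on merged problems *)

Section Closure.
Variables (Q : mxpred F) (s t w : nat).
Hypothesis Qcl : closed Q.

(** Compare the first elements of two chains of equal length: their rows both have rank [s] or, for
    chains of one element, the common end rank. They lie in one class of [Q], so their columns have
    equal rank. *)
Lemma merged_class (K : finType) r c (d : K -> K -> F) :
  merged Q s t w r c d -> forall i j, r i = r j -> c i = c j.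
Proof.
case=> E [hd [dp [m [el [rho [gam [[dpm elK hdE] [mw rE cE] z Qd]]]]]]] i j.
rewrite !rE !cE => /(pack_inj (mw i) (mw j)) [Er Em]; rewrite Em; congr pack.
have [hi di] := hdE i (m i) (leqnn _); have [hj dj] := hdE j (m j) (leqnn _).
have [hi0 di0] := hdE i 0%N (leq0n _); have [hj0 dj0] := hdE j 0%N (leq0n _).
have := cl_class Qcl Qd (el i 0%N) (el j 0%N).
rewrite /ext_row_rank /ext_col_rank hi0 di0 hj0 dj0 Em Er !eqxx.
by case: (0%N == m j) => /esym/eqP.
Qed.

(** If the end rows have different ranks, one row operation on the ends suffices. If the ranks
    agree, chain [l] is the longer one and the ends lie in one class, so the addition has to be a
    conjugation. It is performed along the whole of chain [k], with the two chains aligned at their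
    ends; the only damage is in one column, and row operations repair it. *)
Lemma merged_row (K : finType) r c (d : K -> K -> F) k l a :
  merged Q s t w r c d -> (r l < r k)%N ->
  merged Q s t w r c (fun i j => d i j + (i == k)%:R * a * d l j).
Proof.
case=> E [hd [dp [m [el [rho [gam [ch [mw rE cE] z Qd]]]]]]] rlk.
have [dpm elK hdE] := ch; set d2 := fun i j => _.
have z2 i j : (rho i <= s)%N -> (gam j <= t)%N -> d2 i j = 0.
  move=> ri gj; rewrite /d2 z // add0r; case: eqP => [ik|]; last by rewrite !mul0r.
  rewrite z ?mulr0 //; apply: leq_trans ri; rewrite ik.
  by move: rlk; rewrite !rE pack_lt // => /orP[/ltnW|/andP[/eqP->]].
exists E, hd, dp, m, el, rho, gam; split=> //.
move: rlk; rewrite !rE pack_lt //; case/orP => [rlk|/andP[/eqP rlk mkl]].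
  have := cl_row Qcl (k := el k (m k)) (l := el l (m l)) a Qd.
  have [hk dk] := hdE k (m k) (leqnn _); have [hl dl] := hdE l (m l) (leqnn _).
  rewrite {1 2}/ext_row_rank hk dk hl dl !eqxx => /(_ rlk); congr Q; apply: funext2 => x y.
  rewrite (chain_ext_end ch) (eq_el ch) // /chain_ext /d2 -addrA; congr (_ + _).
  rewrite mulrDr; congr (_ + _); case: (hd x =P k) => [->|_] /=; last by rewrite !mul0r mulr0.
  by case: (dp x == m k); case: (dp y == 0%N); rewrite /= ?(mul0r, mul1r, mulr0, mulr1).
have kl : k != l by apply: contraTneq mkl => ->; rewrite ltnn.
(* The offset that aligns the ends: [el k q] is paired with [el l (q + D)]. *)
set D := (m l - m k)%N.
have D0 : (0 < D)%N by rewrite subn_gt0.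
have Dm : (D <= m l)%N := leq_subr _ _.
(* Paired elements have rows of equal rank, hence columns of equal rank, and [el l D] is not the
   beginning of its chain. *)
have gk : gam k = t.
  have [hk dk] := hdE k 0%N (leq0n _); have [hl dl] := hdE l D Dm.
  have := cl_class Qcl Qd (el k 0%N) (el l D).
  rewrite /ext_row_rank /ext_col_rank hk dk hl dl eqxx rlk (gtn_eqF D0).
  have -> : (D == m l) = (0%N == m k) by lia.
  by case: (0%N == m k); rewrite eqxx => /esym/eqP.
pose P b : E -> E -> F := fun x y =>
  (y == x)%:R + b * (hd x == k)%:R * (y == el l (dp x + D)%N)%:R.
have Pl b (M : E -> E -> F) x y :
    fmul (P b) M x y = M x y + b * (hd x == k)%:R * M (el l (dp x + D)%N) y.
  rewrite /fmul; under eq_bigr do rewrite /P mulrDl -!mulrA.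
  by rewrite big_split /= sum_delta -!big_distrr /= sum_delta mulrA.
have Pr b (M : E -> E -> F) x y : fmul M (P b) x y =
    M x y + b * ((hd y == l) && (D <= dp y)%N)%:R * M x (el k (dp y - D)%N).
  rewrite /fmul; under eq_bigr do rewrite /P mulrDr.
  rewrite big_split /=; congr (_ + _).
    rewrite -[RHS](sum_delta y); apply: eq_bigr => u _.
    by rewrite mulrC eq_sym.
  rewrite -(sum_delta (el k (dp y - D)%N)) big_distrr /=; apply: eq_bigr => u _.
  have key : (hd u == k) && (y == el l (dp u + D)%N) =
    ((hd y == l) && (D <= dp y)%N) && (u == el k (dp y - D)%N).
    have := dpm y; have := dpm u => um ym.
    apply/idP/idP => [/andP[/eqP uk /eqP yE]|/andP[/andP[/eqP yl Dy] /eqP uE]].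
      rewrite uk in um; have [] := hdE l (dp u + D)%N; first by lia.
      by rewrite -yE => -> ->; rewrite eqxx addnK -uk elK leq_addl eqxx.
    rewrite yl in ym; have [] := hdE k (dp y - D)%N; first by lia.
    by rewrite -uE => -> ->; rewrite eqxx subnK // -yl elK eqxx.
  by rewrite mulrC -(mulrA b) bool_mulr key -bool_mulr !mulrA.
have PP b : fmul (P b) (P (- b)) = @fone F E.
  apply: funext2 => x y; rewrite Pl /P /fone eq_sym mulrDr addrA.
  case: (hd x =P k) => [hx|_]; last by rewrite !(mulr0, mul0r, addr0).
  have [|hl dl] := hdE l (dp x + D)%N; first by have := dpm x; rewrite hx; lia.
  rewrite hl [l == k]eq_sym (negPf kl) !(mulr0, mul0r, addr0) !mulr1.
  by rewrite mulNr addrNK.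
have mrkD x : hd x = k -> ext_row_rank hd dp m s rho x = ext_row_rank hd dp m s rho (el l (dp x + D)%N) /\
    ext_col_rank hd dp t gam x = ext_col_rank hd dp t gam (el l (dp x + D)%N).
  move=> hx; have [|hl dl] := hdE l (dp x + D)%N; first by have := dpm x; rewrite hx; lia.
  rewrite /ext_row_rank /ext_col_rank hl dl hx gk rlk; split; last first.
    by rewrite addn_eq0 (gtn_eqF D0) andbF if_same.
  by congr (if _ then _ else _); lia.
have Pc b : compat (ext_row_rank hd dp m s rho) (ext_col_rank hd dp t gam)
    (ext_row_rank hd dp m s rho) (ext_col_rank hd dp t gam) (P b).
  move=> x y; rewrite /P; have [->|_] := eqVneq y x; first by [].
  case: (hd x =P k) => [hx|_]; last by rewrite !(mulr0, mul0r, addr0) eqxx.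
  by case: (y =P _) => [-> _|_]; [apply: mrkD | rewrite mulr0 addr0 eqxx].
(* The conjugate [e] differs from the wanted matrix in column [el l D], the partner of [el k 0]:
   there the last row of each chain receives a multiple of its entry in column [k]. *)
pose v x := a * (dp x == m (hd x))%:R * d2 (hd x) k.
pose e x y := chain_ext hd dp m d2 x y - v x * (y == el l D)%:R.
have d2E i : i != k -> d2 i = d i.
  move=> ik; apply: functional_extensionality => j.
  by rewrite /d2 (negPf ik) !mul0r addr0.
have Qe : Q (ext_row_rank hd dp m s rho) (ext_col_rank hd dp t gam) e.
  apply: (cl_sim Qcl (P := P a) (P' := P (- a)) Qd) => //.
    by rewrite -{2}[a]opprK PP.
  apply: funext2 => x y; rewrite Pl Pr.
  have [hlD dlD] := hdE l D Dm.
  have ek u : hd u = k -> e x u = chain_ext hd dp m d2 x u.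
    move=> hu; rewrite /e; case: eqP => [uE|]; last by rewrite mulr0 subr0.
    by move: kl; rewrite -hu uE hlD eqxx.
  have Be : ((hd y == l) && (D <= dp y)%N)%:R * e x (el k (dp y - D)%N) =
      ((hd y == l) && (D <= dp y)%N)%:R * chain_ext hd dp m d2 x (el k (dp y - D)%N).
    case: eqP => [hy|_]; last by rewrite !mul0r.
    by rewrite ek //; have [|//] := hdE k (dp y - D)%N; have := dpm y; rewrite hy; lia.
  rewrite -!mulrA Be {1}/e.
  have [/andP[/eqP hx xm]|nx] := boolP ((hd x == k) && (dp x != m k)).
    have xm' : (dp x < m k)%N by have := dpm x; rewrite hx; lia.
    have -> : x = el k (dp x) by rewrite -hx elK.
    have [hq dq] := hdE k (dp x) (ltnW xm').
    rewrite /v hq dq (ltn_eqF xm') eqxx !(chain_ext_mid ch) ?(eq_el ch) //; try by lia.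
    rewrite !(mulr0, mul0r, subr0) mul1r bool_mulr; congr (_ + _ * (nat_of_bool _)%:R).
    case: (hd y =P l) => //= hy; case: (leqP D (dp y)) => /= yD; last by lia.
    have [|-> ->] := hdE k (dp y - D)%N; first by have := dpm y; rewrite hy; lia.
    by rewrite eqxx; lia.
  have -> : chain_ext hd dp m d x y + a * ((hd x == k)%:R * chain_ext hd dp m d (el l (dp x + D)%N) y)
      = chain_ext hd dp m d2 x y.
    have [hx|hx] := eqVneq (hd x) k; last by rewrite mul0r mulr0 addr0 /chain_ext d2E.
    move: nx; rewrite hx eqxx negbK => /eqP xm.
    have -> : x = el k (m k) by rewrite -xm -hx elK.
    have [_ ->] := hdE k (m k) (leqnn _); rewrite subnKC 1?ltnW // !(chain_ext_end ch) /d2.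
    by rewrite eqxx !mul1r mulrDr mulrCA.
  rewrite -addrA -[LHS]addr0; congr (_ + _).
  case: (hd y =P l) => [hy|hy]; last first.
    by rewrite (eq_el ch) // (introF eqP hy) !(mulr0, mul0r, oppr0, addr0).
  case: (leqP D (dp y)) => yD; last first.
    by rewrite (eq_el ch) // (ltn_eqF yD) andbF !(mulr0, mul0r, oppr0, addr0).
  have [|hk dk] := hdE k (dp y - D)%N; first by have := dpm y; rewrite hy; lia.
  rewrite (eq_el ch) // hy eqxx /= mul1r /chain_ext /shift hk dk /v.
  have -> : (hd x == k) && (dp y - D == (dp x).+1)%N = false.
    by apply: contraNF nx => /andP[-> /=]; have := dpm y; rewrite hy; lia.
  have -> : (dp y - D == 0)%N = (dp y == D) by lia.
  rewrite add0r; case: (dp x == _); case: (dp y == D);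
    by rewrite !(mulr1, mul1r, mulr0, mul0r, oppr0, addr0, addNr).
(* The only entry of row [el l D.-1] is a 1 in column [el l D], so this row clears [v]. It has rank
   [s], whereas [v x] can be nonzero only in a row of larger rank, because [gam k = t] and [d2]
   vanishes at ranks up to [s] and [t]. *)
have [|hl0 dl0] := hdE l D.-1; first by lia.
have := @cl_rows _ _ Qcl _ _ _ _ (el l D.-1) v Qe.
have <- : chain_ext hd dp m d2 = fun x y => e x y + v x * e (el l D.-1) y.
  apply: funext2 => x y; rewrite {2}/e (chain_ext_mid ch); last by lia.
  rewrite prednK // {2}/v hl0 dl0; have -> : (D.-1 == m l) = false by lia.
  by rewrite !(mulr0, mul0r, subr0) /e subrK.
apply=> x; rewrite /v /ext_row_rank hl0 dl0; have -> : (D.-1 == m l) = false by lia.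
case: (dp x == _); last by rewrite mulr0 mul0r eqxx.
by rewrite ltnNge; apply: contraNN => xs; rewrite z2 ?mulr0 // gk.
Qed.

End Closure.

(** A matrix that pairs chains of equal length lifts to elements by acting at each depth separately;
    sums over elements then reduce to sums over chains. *)
Lemma lift_sum (E E' K K' : finType) (hd : E -> K) dp m el (hd' : E' -> K') dp' m' el'
    (M : K -> K' -> F) (f : E' -> F) x :
  chain_struct hd dp m el -> chain_struct hd' dp' m' el' ->
  (forall k l, M k l != 0 -> m k = m' l) ->
  \sum_y M (hd x) (hd' y) * (dp x == dp' y)%:R * f y =
  \sum_l M (hd x) l * f (el' l (dp x)).
Proof.
move=> [dpm _ _] [dpm' elK' hdE'] mM; rewrite (partition_big hd' xpredT) //=.
apply: eq_bigr => l _; have [M0|/mM mE] := eqVneq (M (hd x) l) 0.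
  by rewrite M0 mul0r big1 // => y /eqP->; rewrite M0 !mul0r.
have [|hl dl] := hdE' l (dp x); first by rewrite -mE.
rewrite (bigD1 (el' l (dp x))) /= ?hl // dl eqxx mulr1 big1 ?addr0 //.
move=> y /andP[/eqP<- /negPf ny]; case: eqP => [xy|_]; last by rewrite mulr0 mul0r.
by rewrite xy elK' eqxx in ny.
Qed.

(** The column operation is the row operation of the transposed problem. A base change on chains
    mixes only chains of equal length, as the packed ranks record the length, and so lifts depth by
    depth to the elements. *)
Lemma merged_closed (Q : mxpred F) s t w : closed Q -> closed (merged Q s t w).
Proof.
move=> Qcl; have Tcl := trp_closed Qcl; split.
- move=> I r c d Qd i j; apply/eqP/eqP; first exact: (merged_class Qcl Qd).
  exact: (@merged_class (trp Q) t s w Tcl I c r (fun i j => d j i) (merged_trp Qd)).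
- by move=> I r c d k l a Qd lk; apply: merged_row.
- move=> I r c d k l a Qd lk.
  apply: (@merged_trp (trp Q) t s w I r c).
  have Qd' := @merged_trp Q s t w I c r (fun i j => d j i) Qd.
  exact: (merged_row Tcl a Qd' lk).
move=> I J r c d r' c' e P P' [E [hd [dp [m [el [rho [gam [ch [mw rE cE] z Qd]]]]]]]].
move=> PP' P'P Pc P'c Pde; have [dpm elK hdE] := ch.
have Pex j : exists i, P j i != 0.
  apply/existsP; apply: contraT => /existsPn Pj0.
  have /eqP := congr1 (fun f => f j j) PP'; rewrite /fmul big1 /fone ?eqxx => [|i _].
    by rewrite eq_sym oner_eq0.
  by have := Pj0 i; rewrite negbK => /eqP->; rewrite mul0r.
(* The new chain [j] takes length and ranks from an old chain occurring in row [j] of [P]; by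
   compatibility the choice is immaterial. *)
pose g j := xchoose (Pex j); have gP j : P j (g j) != 0 := xchooseP (Pex j).
pose m' j := m (g j); pose rho' j := rho (g j); pose gam' j := gam (g j).
have Pm j i : P j i != 0 -> [/\ m' j = m i, rho' j = rho i & gam' j = gam i].
  move=> /Pc[ri ci]; have [rg cg] := Pc _ _ (gP j).
  move: rg cg; rewrite ri ci !rE !cE => /(pack_inj (mw _) (mw _))[rh mh].
  by move=> /(pack_inj (mw _) (mw _))[gh _]; rewrite /m' /rho' /gam' rh mh gh.
have P'm i j : P' i j != 0 -> [/\ m' j = m i, rho' j = rho i & gam' j = gam i].
  move=> /P'c[ri ci]; have [rg cg] := Pc _ _ (gP j).
  move: rg cg; rewrite -ri -ci !rE !cE => /(pack_inj (mw _) (mw _))[rh mh].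
  by move=> /(pack_inj (mw _) (mw _))[gh _]; rewrite /m' /rho' /gam' rh mh gh.
pose E' := {j : J & 'I_(m' j).+1}.
pose hd' (x : E') := tag x; pose dp' (x : E') : nat := tagged x.
pose el' j q : E' := Tagged (fun j => 'I_(m' j).+1) (inord q : 'I_(m' j).+1).
have ch' : chain_struct hd' dp' m' el'.
  split=> [x|x|j q qm]; first by rewrite -ltnS ltn_ord.
    by rewrite /el' /hd' /dp' inord_val; case: x.
  by rewrite /hd' /dp' /= inordK.
have hdE' : forall j q, (q <= m' j)%N -> hd' (el' j q) = j /\ dp' (el' j q) = q.
  by case: ch'.
pose L x y := P (hd' x) (hd y) * (dp' x == dp y)%:R.
pose L' y x := P' (hd y) (hd' x) * (dp y == dp' x)%:R.
have Lsum f x : \sum_y L x y * f y = \sum_l P (hd' x) l * f (el l (dp' x)).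
  by apply: (lift_sum _ _ ch' ch) => j i /Pm[].
have L'sum f y : \sum_x L' y x * f x = \sum_l P' (hd y) l * f (el' l (dp y)).
  by apply: (lift_sum _ _ ch ch') => i j /P'm[].
have sumL f y : \sum_x f x * L x y = \sum_j f (el' j (dp y)) * P j (hd y).
  have PmT i j : P j i != 0 -> m i = m' j by move=> /Pm[].
  transitivity (\sum_j P j (hd y) * f (el' j (dp y))).
    have /= <- := lift_sum f y ch ch' PmT.
    by apply: eq_bigr => x _ /=; rewrite mulrC /L [dp y == _]eq_sym.
  by apply: eq_bigr => j _ /=; rewrite mulrC.
exists E', hd', dp', m', el', rho', gam'; split=> //.
- split=> j; first exact: mw.
    by have [-> _] := Pc _ _ (gP j); rewrite rE.
  by have [_ ->] := Pc _ _ (gP j); rewrite cE.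
- move=> k l rk gl.
  have -> : e = fmul (fmul P d) P' by rewrite Pde -fmulA PP' fmul1r.
  rewrite /fmul big1 // => j _; have [->|/P'm[_ _ gj]] := eqVneq (P' j l) 0.
    by rewrite mulr0.
  rewrite big1 ?mul0r // => i _; have [->|/Pm[_ ri _]] := eqVneq (P k i) 0.
    by rewrite mul0r.
  by rewrite z ?mulr0 // -?ri -?gj.
apply: (cl_sim Qcl (P := L) (P' := L') Qd).
- apply: funext2 => x y; rewrite /fmul Lsum.
  transitivity (fmul P P' (hd' x) (hd' y) * (dp' x == dp' y)%:R).
    rewrite /fmul big_distrl; apply: eq_bigr => i _ /=; rewrite /L' mulrA.
    have [->|/Pm[mi _ _]] := eqVneq (P (hd' x) i) 0; first by rewrite !mul0r.
    by have [|-> ->] := hdE i (dp' x); first by rewrite -mi; case: ch'.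
  rewrite PP' /fone -natrM mulnb; congr (nat_of_bool _)%:R.
  apply/andP/eqP => [[/eqP hxy /eqP dxy]|->]; last by rewrite !eqxx.
  by case: ch' => _ elK' _; rewrite -(elK' x) -(elK' y) hxy dxy.
- apply: funext2 => x y; rewrite /fmul L'sum.
  transitivity (fmul P' P (hd x) (hd y) * (dp x == dp y)%:R).
    rewrite /fmul big_distrl; apply: eq_bigr => i _ /=; rewrite /L mulrA.
    have [->|/P'm[mi _ _]] := eqVneq (P' (hd x) i) 0; first by rewrite !mul0r.
    by have [|-> ->] := hdE' i (dp x); first by rewrite mi.
  rewrite P'P /fone -natrM mulnb; congr (nat_of_bool _)%:R.
  apply/andP/eqP => [[/eqP hxy /eqP dxy]|->]; last by rewrite !eqxx.
  by rewrite -(elK x) -(elK y) hxy dxy.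
- move=> x y; rewrite /L; case: (dp' x =P dp y) => [dxy|_]; last by rewrite mulr0 eqxx.
  by rewrite mulr1 => /Pm[mE rhE gE]; rewrite /ext_row_rank /ext_col_rank mE rhE gE dxy.
- move=> x y; rewrite /L'; case: (dp x =P dp' y) => [dxy|_]; last by rewrite mulr0 eqxx.
  by rewrite mulr1 => /P'm[mE rhE gE]; rewrite /ext_row_rank /ext_col_rank mE rhE gE dxy.
apply: funext2 => x y; rewrite /fmul Lsum sumL.
pose G := P (hd' x) (hd y) * (dp y == (dp' x).+1)%:R +
  ((dp' x == m' (hd' x)) && (dp y == 0%N))%:R * fmul P d (hd' x) (hd y).
transitivity G.
  rewrite /G -(sum_delta (hd y) (P (hd' x))) big_distrl /fmul big_distrr -big_split.
  apply: eq_bigr => i _ /=.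
  have [->|/Pm[mi _ _]] := eqVneq (P (hd' x) i) 0; first by rewrite !(mul0r, mulr0, addr0).
  have [|hi di] := hdE i (dp' x); first by rewrite -mi; case: ch'.
  rewrite /chain_ext /shift hi di mi mulrDr -bool_mulr mulrCA mulrA; congr (_ + _).
  by rewrite mulrCA.
rewrite /G Pde -(sum_delta (hd' x) (P ^~ (hd y))) big_distrl /fmul big_distrr -big_split.
apply: eq_bigr => j _ /=.
have [->|/Pm[mi _ _]] := eqVneq (P j (hd y)) 0; first by rewrite !(mul0r, mulr0, addr0).
have [|hi di] := hdE' j (dp y); first by rewrite mi.
rewrite /chain_ext /shift hi di mulrDl [hd' x == j]eq_sym -!mulrA; congr (_ + _).
by rewrite -bool_mulr -mulrA [P j _ * _]mulrC.
Qed.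

End Merge.

(** * Splitting off a cyclic summand *)

Section Cyclic.
Variable F : fieldType.
Implicit Types p q f g u : {poly F}.

Lemma irredp_exists f : (1 < size f)%N -> exists2 q, irreducible_poly q & q %| f.
Proof.
have [n] := ubnP (size f); elim: n f => // n IHn f fn f1.
have [irr|nirr] := classic (irreducible_poly f); first by exists f.
have [q [q1 [qf qnf]]] : exists q, size q != 1%N /\ (q %| f /\ ~~ (q %= f)).
  apply: NNPP => H; apply: nirr; split=> // q q1 qf.
  by apply: contraT => nq; case: H; exists q.
have f0 : f != 0 by rewrite -size_poly_gt0; lia.
have q0 : q != 0 by apply: contraTneq qf => ->; rewrite dvd0p.
have qs : (size q < size f)%N.
  rewrite ltn_neqAle dvdp_leq // andbT; apply: contra qnf => /eqP sq.
  by rewrite -dvdp_size_eqp // sq.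
have [||r irr rq] := IHn q; [by lia | by move: q0; rewrite -size_poly_gt0; lia |].
by exists r => //; apply: dvdp_trans rq qf.
Qed.

Lemma irredp_factor q f : irreducible_poly q -> f != 0 ->
  exists e g, f = q ^+ e * g /\ coprimep q g.
Proof.
move=> irr; have [n] := ubnP (size f); elim: n f => // n IHn f fn f0.
have [/dvdpP[g fE]|nqf] := boolP (q %| f); last first.
  exists 0%N, f; rewrite expr0 mul1r; split=> //.
  by rewrite irreducible_poly_coprime.
have g0 : g != 0 by apply: contraNneq f0 => g0; rewrite fE g0 mul0r.
have := irr.1; have := irredp_neq0 irr => q0 q1.
have [|e [h [gE co]]] := IHn g _ g0.
  have sg : (0 < size g)%N by rewrite size_poly_gt0.
  by move: fn; rewrite fE size_mul //; move: sg q1; move: (size g) (size q) => a b; lia.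
by exists e.+1, h; rewrite fE gE exprSr; split=> //; rewrite mulrAC.
Qed.

(** The gcd of [p] and [q ^+ e] is a power of [q] with exponent below [e], because [p] is too small
    to be a multiple of [q ^+ e]; hence it divides [q ^+ e.-1]. *)
Lemma local_bezout q e p : irreducible_poly q -> p != 0 ->
  (size p < size (q ^+ e))%N -> exists b w, b * p + w * q ^+ e = q ^+ e.-1.
Proof.
move=> irr p0 sp; have [k [p' [pE co]]] := irredp_factor irr p0.
have ke : (k < e)%N.
  rewrite ltnNge; apply: contraL sp => ek; rewrite -leqNgt dvdp_leq //.
  by rewrite pE -(subnK ek) exprD -mulrA dvdp_mull // dvdp_mulr.
have /Bezout_eq1_coprimepP[[u v] /= uv] : coprimep p' (q ^+ e).
  by rewrite coprimep_expr // coprimep_sym.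
exists (q ^+ (e.-1 - k) * u), (q ^+ e.-1 * v).
have -> : q ^+ e.-1 = q ^+ (e.-1 - k) * q ^+ k by rewrite -exprD subnK //; lia.
by rewrite pE -[RHS]mulr1 -uv; ring.
Qed.


Section Krylov.
Variables (n : nat) (M : 'M[F]_n.+1) (v : 'rV[F]_n.+1) (m : nat) (u : {poly F}).

Definition krylov := \matrix_(i < m.+1) (v *m M ^+ i).
(** The companion matrix of [u] divided by its leading coefficient. *)
Definition compmx := \matrix_(i < m.+1, j < m.+1)
  if (i < m)%N then (j == i.+1 :> nat)%:R else - (u`_j / lead_coef u) : F.

Lemma krylov_poly (a : 'rV[F]_m.+1) : a *m krylov = v *m horner_mx M (rVpoly a).
Proof.
rewrite horner_rVpoly mulmx_sum_row [a *m powers_mx _ _]mulmx_sum_row linear_sum mulmx_sumr; apply: eq_bigr => i _.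
by rewrite !rowK linearZ /= mxvecK -scalemxAr.
Qed.

Lemma krylov_stable : size u = m.+2 -> v *m horner_mx M u = 0 ->
  krylov *m M = compmx *m krylov.
Proof.
move=> su vu; have lu : lead_coef u != 0 by rewrite lead_coef_eq0 -size_poly_gt0 su.
apply/row_matrixP => i; rewrite !row_mul rowK -mulmxA -[_ *m M]exprSr.
rewrite [RHS]mulmx_sum_row; case: (ltnP i m) => im.
  rewrite (bigD1 (inord i.+1)) //= !mxE rowK im inordK // eqxx scale1r big1 ?addr0 //.
  move=> j ji; rewrite !mxE im; case: eqP => [jE|]; last by rewrite scale0r.
  by case/eqP: ji; apply: val_inj; rewrite /= inordK.
have -> : i = m :> nat by apply/eqP; rewrite eqn_leq im -ltnS ltn_ord.
move: vu; rewrite -[u in horner_mx _ u]coefK poly_def su rmorph_sum /= big_ord_recr /=.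
rewrite mulmxDr mulmx_sumr linearZ /= rmorphXn /= horner_mx_X -scalemxAr.
have -> : u`_m.+1 = lead_coef u by rewrite lead_coefE su.
move=> /(canRL (addKr _)); rewrite addr0 => /(canRL (scalerK lu)) ->.
rewrite scalerN scaler_sumr -sumrN; apply: eq_bigr => j _.
rewrite !mxE ltnNge im /= rowK horner_mxZ rmorphXn /= horner_mx_X -scalemxAr.
by rewrite scalerA scaleNr mulrC.
Qed.

End Krylov.

(** The lower left corner is the constant term of [q ^+ e] up to a nonzero factor. It vanishes only
    if [q] is proportional to [X], and then the whole last row vanishes: the block is a nilpotent
    Jordan block. *)
Lemma compmx_const m q e : irreducible_poly q -> size (q ^+ e) = m.+2 ->
  (forall j, compmx m (q ^+ e) ord_max j = 0) \/ compmx m (q ^+ e) ord_max ord0 != 0.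
Proof.
move=> irr sq; have q0 := irredp_neq0 irr.
have lq : lead_coef (q ^+ e) != 0 by rewrite lead_coef_eq0 -size_poly_gt0 sq.
have [rq|nrq] := boolP (root q 0); [left => j | right]; rewrite mxE ltnn.
  have Xq : 'X %| q by rewrite -[X in X %| _]subr0 dvdp_XsubCl.
  have /eqpfP : q %= 'X by rewrite eqp_sym irr ?size_polyX.
  set c := (_ / _) => qX; move: sq lq; rewrite qX exprZn lead_coefZ.
  rewrite lead_coefXn mulr1 => sq lq.
  move: sq; rewrite size_scale // size_polyXn => -[em].
  by rewrite coefZ coefXn em (ltn_eqF (ltn_ord j)) mulr0 mul0r oppr0.
rewrite oppr_eq0 mulf_neq0 ?invr_eq0 // -horner_coef0 hornerE expf_neq0 //.
Qed.


Lemma horner_mx_tr n (M : 'M[F]_n.+1) p : horner_mx M^T p = (horner_mx M p)^T.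
Proof.
have trX k : (M ^+ k)^T = M^T ^+ k.
  by elim: k => [|k IHk]; rewrite ?trmx1 // exprS exprSr trmx_mul IHk.
rewrite -[p]coefK poly_def !rmorph_sum /= linear_sum; apply: eq_bigr => i _.
by rewrite !horner_mxZ !rmorphXn /= !horner_mx_X linearZ /= trX.
Qed.

(* With minimal polynomial [q ^+ e * g], [q] prime to [g], the vector
   [e_i g(M)] and the functional [g(M) e_j] generate cyclic modules that pair
   perfectly, so the first is complemented by the annihilator of the second. *)
Lemma cyclic_split n (M : 'M[F]_n.+1) :
  exists m n2 (C : 'M[F]_(m.+1, n.+1)) (B : 'M[F]_(n2, n.+1)) (C' : 'M[F]_(n.+1, m.+1))
    (B' : 'M[F]_(n.+1, n2)) (b : 'M[F]_m.+1) (f : 'M[F]_n2),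
  [/\ C *m M = b *m C /\ B *m M = f *m B,
      [/\ C *m C' = 1%:M, C *m B' = 0, B *m C' = 0 & B *m B' = 1%:M],
      C' *m C + B' *m B = 1%:M,
      forall i j : 'I_m.+1, (i < m)%N -> b i j = (j == i.+1 :> nat)%:R
    & (forall j, b ord_max j = 0) \/ b ord_max ord0 != 0].
Proof.
pose N (p : {poly F}) := horner_mx M p.
have ND p r : N (p + r) = N p + N r by rewrite /N rmorphD.
have NM p r : N p *m N r = N (p * r) by rewrite /N rmorphM.
have f1 : (1 < size (mxminpoly M))%N by rewrite size_mxminpoly ltnS mxminpoly_nonconstant.
have f0 : mxminpoly M != 0 by rewrite -size_poly_gt0 ltnW.
have [q irr qf] := irredp_exists f1.
have [e [g [fE co]]] := irredp_factor irr f0.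
have e0 : (0 < e)%N.
  rewrite lt0n; apply: contraTneq qf => e0.
  by rewrite fE e0 expr0 mul1r -irreducible_poly_coprime.
have q0 := irredp_neq0 irr.
have qg0 : q ^+ e.-1 * g != 0.
  rewrite mulf_neq0 ?expf_neq0 //; apply: contraNneq f0 => g0.
  by rewrite fE g0 mulr0.
(* The minimal polynomial [q ^+ e * g] does not divide this product, as [q] is prime to [g]. A
   nonzero entry [(i, j)] selects the vector and the functional. *)
have : N (g * (q ^+ e.-1 * g)) != 0.
  rewrite -dvd_mxminpoly fE -{1}(prednK e0) exprS -mulrA dvdp_mul2r //.
  by rewrite -irreducible_poly_coprime.
case/matrix0Pn => i [j Nij].
set u := q ^+ e.
have su : size u = (size u).-2.+2.
  have : (0 < (size u).-1)%N.
    by rewrite size_exp muln_gt0 e0 andbT; case: (size q) irr.1 => [|[|]].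
  by case: (size u) => [|[|]].
move: (size u).-2 su => m su.
pose v : 'rV_n.+1 := delta_mx 0 i *m N g.
pose l : 'cV_n.+1 := N g *m delta_mx j 0.
have vu : v *m N u = 0.
  by rewrite -mulmxA NM mulrC -fE [N _]mx_root_minpoly mulmx0.
have lu : l^T *m horner_mx M^T u = 0.
  rewrite horner_mx_tr -trmx_mul mulmxA NM -fE [N _]mx_root_minpoly.
  by rewrite mul0mx trmx0.
have vNl : v *m N (q ^+ e.-1) *m l <> 0.
  have -> : v *m N (q ^+ e.-1) *m l =
      delta_mx 0 i *m N (g * (q ^+ e.-1 * g)) *m delta_mx j 0 by rewrite -!NM !mulmxA.
  move/matrixP/(_ 0 0); rewrite -rowE -colE !mxE => Nij0; by rewrite Nij0 eqxx in Nij.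
move: v l vu lu vNl => v l vu lu vNl.
pose C := krylov M v m; pose L := (krylov M^T l^T m)^T; pose b := compmx m u.
have CM : C *m M = b *m C by apply: krylov_stable.
have ML : M *m L = L *m b^T.
  by rewrite -[M]trmxK -!trmx_mul; congr (_^T); apply: krylov_stable.
(* A row [a] in the kernel of the pairing is a polynomial of degree at most [m]. If it is nonzero, a
   Bezout multiplier [c] turns it into [q ^+ e.-1] modulo [u], and this contradicts [vNl]. Reducing
   [c] modulo [u] makes its action on [l] a combination of the columns of [L]. *)
have CLu : C *m L \in unitmx.
  rewrite -row_free_unit -kermx_eq0; apply/eqP/row_matrixP => k; rewrite row0.
  have : row k (kermx (C *m L)) *m (C *m L) = 0 by rewrite -row_mul mulmx_ker row0.
  move: (row k _) => a; rewrite mulmxA krylov_poly -/(N _) => aCL.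
  apply/eqP; apply: contraT => a0.
  have [||c [w cw]] := @local_bezout q e (rVpoly a) irr.
  - by apply: contraNneq a0 => E; rewrite -[a]rVpolyK E linear0.
  - by rewrite -/u su ltnS size_poly.
  have Lpoly (r : {poly F}) : (size r <= m.+1)%N -> N r *m l = L *m (poly_rV r)^T.
    move=> sr; rewrite /L -trmx_mul krylov_poly poly_rV_K // horner_mx_tr.
    by rewrite -trmx_mul trmxK.
  case: vNl; rewrite -cw -/u ND mulmxDr mulmxDl -[w * u]mulrC -!NM.
  rewrite [v *m (N u *m N w)]mulmxA vu !mul0mx addr0 [c in N c](divp_eq c u).
  rewrite ND mulmxDl mulmxDr mulmxDl -!NM.
  have commN x y : N x *m N y = N y *m N x by rewrite !NM mulrC.
  rewrite [N (c %/ u) *m N u]commN !mulmxA vu !mul0mx add0r -(mulmxA v) commN.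
  rewrite mulmxA -mulmxA Lpoly ?mulmxA ?aCL ?mul0mx //.
  by rewrite -ltnS -su ltn_modp -size_poly_gt0 su.
have rB : ((row_base (kermx L)) *m M <= row_base (kermx L))%MS.
  rewrite !eq_row_base; apply/sub_kermxP; rewrite -mulmxA ML mulmxA.
  have /sub_kermxP -> : (row_base (kermx L) <= kermx L)%MS by rewrite eq_row_base.
  by rewrite mul0mx.
set B := row_base (kermx L) in rB *.
have BL : B *m L = 0 by apply/sub_kermxP; rewrite eq_row_base.
have [f BM] := submxP rB.
pose C' := L *m invmx (C *m L).
have CC' : C *m C' = 1%:M by rewrite mulmxA mulmxV.
have BC' : B *m C' = 0 by rewrite mulmxA BL mul0mx.
have : (1%:M - C' *m C <= B)%MS.
  rewrite eq_row_base; apply/sub_kermxP.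
  by rewrite mulmxBl mul1mx -mulmxA -mulmxA mulVmx // mulmx1 subrr.
case/submxP => B' B'E.
have CB : C' *m C + B' *m B = 1%:M by rewrite -B'E addrC subrK.
have Bfree : row_free B := row_base_free _.
exists m, (\rank (kermx L)), C, B, C', B', b, f; split=> //.
- split=> //; apply: (row_free_inj Bfree).
    rewrite -mulmxA mul0mx; have := congr1 (mulmx C) CB.
    by rewrite mulmxDr mulmxA CC' mul1mx mulmx1 => /(canRL (addKr _)); rewrite addNr.
  rewrite -mulmxA mul1mx; have := congr1 (mulmx B) CB.
  by rewrite mulmxDr mulmxA BC' mul0mx add0r mulmx1.
- by move=> x y xm; rewrite mxE xm.
exact: compmx_const.
Qed.

End Cyclic.

(** * Square matrices up to similarity *)

Section SimilarityForm.
Variable F : fieldType.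

Lemma fmul_mx m n p (A : 'M[F]_(m, n)) (B : 'M[F]_(n, p)) :
  fmul (fun i j => A i j) (fun i j => B i j) = fun i j => (A *m B) i j.
Proof. by apply: funext2 => i j; rewrite mxE. Qed.

Lemma fone_mx n : @fone F 'I_n = fun i j => (1%:M : 'M[F]_n) i j.
Proof. by apply: funext2 => i j; rewrite mxE. Qed.

Lemma enum_bij (X : finType) n : #|X| = n ->
  exists (f : 'I_n -> X) g, cancel f g /\ cancel g f.
Proof. by move=> <-; exists enum_val, enum_rank; split; [exact: enum_valK | exact: enum_rankK]. Qed.

Lemma compmx_unit m (b : 'M[F]_m.+1) :
  (forall i j : 'I_m.+1, (i < m)%N -> b i j = (j == i.+1 :> nat)%:R) ->
  b ord_max ord0 != 0 -> b \in unitmx.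
Proof.
move=> bE b0; rewrite -row_free_unit -kermx_eq0; apply/eqP/row_matrixP => k; rewrite row0.
have : row k (kermx b) *m b = 0 by rewrite -row_mul mulmx_ker row0.
move: (row k _) => u /matrixP ub.
have um : u 0 ord_max = 0.
  apply/eqP; have /eqP := ub 0 ord0; rewrite !mxE big_ord_recr /= big1 => [|i _].
    by rewrite add0r mulf_eq0 (negPf b0) orbF.
  by rewrite bE //= mulr0.
apply/matrixP => z i; rewrite (ord1 z) mxE.
case: (ltnP i m) => im; last first.
  by rewrite -um; congr (u _ _); apply/val_inj/eqP; rewrite eqn_leq -ltnS ltn_ord im.
have := ub 0 (inord i.+1); rewrite !mxE (bigD1 i) //= bE // inordK // eqxx mulr1.
rewrite big1 ?addr0 // => j ji; case: (ltnP j m) => jm.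
  by rewrite bE // inordK // eqSS eq_sym val_eqE (negPf ji) mulr0.
suff -> : j = ord_max by rewrite um mul0r.
by apply/val_inj/eqP; rewrite /= eqn_leq -ltnS ltn_ord jm.
Qed.

(** Cyclic summands are split off until an invertible one appears or nothing is left. The others are
    chains already and together form a [shift]. One invertible block is enough, since the reduction
    continues with the remaining indices. *)
Lemma band_or_shift (X : finType) (f : X -> X -> F) :
  (exists m b b' (Y : finType) (g : Y -> Y -> F),
    [/\ fmul b b' = @fone F 'I_m.+1, fmul b' b = @fone F 'I_m.+1,
        forall i j : 'I_m.+1, (i < m)%N -> b i j = (j == i.+1 :> nat)%:R
      & sim f (blockd b g)]) \/
  exists (E K : finType) hd dp m el,
    @chain_struct E K hd dp m el /\ sim f (shift F hd dp).
Proof.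
have [n] := ubnP #|X|; elim: n X f => // n IHn X f /ltnSE Xn.
case E : #|X| => [|k].
  right; exists X, X, id, (fun=> 0%N), (fun=> 0%N), (fun x _ => x).
  split; first by split=> // x q; rewrite leqn0 => /eqP->.
  have X0 (x : X) : False by have := fintype0 x E.
  suff -> : f = shift F id (fun=> 0%N) by exact: sim_refl.
  by apply: funext2 => x; case: (X0 x).
have [e [e' [eK e'K]]] := enum_bij E.
pose M := \matrix_(i, j) f (e i) (e j).
have fM : sim f (fun i j => M i j).
  rewrite (_ : (fun i j => M i j) = fun i j => f (e i) (e j)); first exact: sim_reindex eK e'K.
  by apply: funext2 => i j; rewrite mxE.
have [m [n2 [C [B [C' [B' [b [g]]]]]]]] := cyclic_split M.
case=> -[CM BM] [CC' CB' BC' BB'] C1 bE bl.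
pose P (x : 'I_m.+1 + 'I_n2) i := match x with inl j => C j i | inr j => B j i end.
pose P' i (x : 'I_m.+1 + 'I_n2) := match x with inl j => C' i j | inr j => B' i j end.
have fb : sim f (blockd (fun i j => b i j) (fun i j => g i j)).
  apply: (sim_trans fM); exists P, P'; split.
  - rewrite -blockd1; apply: funext2 => -[i|i] [j|j]; rewrite /fmul /P /P' /=.
    + by rewrite fone_mx -CC' mxE.
    + by have /matrixP/(_ i j) := CB'; rewrite !mxE.
    + by have /matrixP/(_ i j) := BC'; rewrite !mxE.
    + by rewrite fone_mx -BB' mxE.
  - by rewrite fone_mx -C1; apply: funext2 => i j; rewrite /fmul big_sumType /= !mxE.
  apply: funext2 => -[i|i] j; rewrite /fmul big_sumType /=.
    rewrite [X in _ + X]big1 ?addr0 => [|? _]; last by rewrite mul0r.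
    by have /matrixP/(_ i j) := CM; rewrite !mxE.
  rewrite [X in X + _]big1 ?add0r => [|? _]; last by rewrite mul0r.
  by have /matrixP/(_ i j) := BM; rewrite !mxE.
have band : b ord_max ord0 != 0 -> (exists b', fmul (fun i j => b i j) b' = @fone F _ /\
    fmul b' (fun i j => b i j) = @fone F _).
  move=> /(compmx_unit bE) bu; exists (fun i j => invmx b i j).
  by rewrite !fmul_mx mulmxV // mulVmx // fone_mx.
case: bl => [bl|/band[b' [bb' b'b]]]; last first.
  by left; exists m, (fun i j => b i j), b', 'I_n2, (fun i j => g i j); split.
have [||] := IHn 'I_n2 (fun i j => g i j).
- have := sim_card fb; rewrite card_sum !card_ord; lia.
- case=> m' [b1 [b1' [Y [h [bb1 b1b b1E sg]]]]]; left.
  exists m', b1, b1', ('I_m.+1 + Y)%type, (blockd (fun i j => b i j) h); split=> //.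
  apply: (sim_trans fb); apply: (sim_trans (sim_blockd (sim_refl _) sg)).
  pose s (x : 'I_m'.+1 + ('I_m.+1 + Y)) : 'I_m.+1 + ('I_m'.+1 + Y) :=
    match x with inl i => inr (inl i) | inr (inl i) => inl i | inr (inr y) => inr (inr y) end.
  pose s' (x : 'I_m.+1 + ('I_m'.+1 + Y)) : 'I_m'.+1 + ('I_m.+1 + Y) :=
    match x with inl i => inr (inl i) | inr (inl i) => inl i | inr (inr y) => inr (inr y) end.
  rewrite (_ : blockd b1 _ =
    fun i j => blockd (fun i j => b i j) (blockd b1 h) (s i) (s j)).
    by apply: (@sim_reindex _ _ _ _ s s'); do 2?case.
  by apply: funext2 => -[i|[i|i]] [j|[j|j]].
case=> E2 [K [hd [dp [mm [el [[dpm elK hdE] sg]]]]]]; right.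
pose hd' (x : 'I_m.+1 + E2) := match x with inl _ => None | inr y => Some (hd y) end.
pose dp' (x : 'I_m.+1 + E2) : nat := match x with inl i => i | inr y => dp y end.
pose mm' (k : option K) := if k is Some k then mm k else m.
pose el' (k : option K) q : 'I_m.+1 + E2 :=
  if k is Some k then inr (el k q) else inl (inord q).
exists ('I_m.+1 + E2)%type, (option K), hd', dp', mm', el'; split.
  split=> [[i|y]|[i|y]|[k0|] q qm] /=.
  - by rewrite -ltnS.
  - exact: dpm.
  - by rewrite inord_val.
  - by rewrite elK.
  - by have [-> ->] := hdE _ _ qm.
  - by rewrite inordK.
apply: (sim_trans fb); rewrite (_ : shift F hd' dp' = blockd (fun i j => b i j) (shift F hd dp)).
  exact: sim_blockd (sim_refl _) sg.
apply: funext2 => -[i|i] [j|j] //=; rewrite /shift /=.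
case: (ltnP i m) => im; first by rewrite bE.
have -> : i = ord_max by apply/val_inj/eqP; rewrite /= eqn_leq -ltnS ltn_ord im.
by rewrite bl /= (ltn_eqF (ltn_ord j)).
Qed.

End SimilarityForm.

(** * Normal form of a cell *)

Section CellNormalForm.
Variable F : fieldType.

(** Serves the cells whose rows and columns lie in different classes and are therefore transformed
    independently. *)
Lemma rank_form (S T : finType) (M : S -> T -> F) :
  exists a b k (P : 'I_a -> S -> F) P' (R : 'I_b -> T -> F) R',
    [/\ fmul P P' = @fone F _ /\ fmul P' P = @fone F _,
        fmul R R' = @fone F _ /\ fmul R' R = @fone F _, (k <= a)%N, (k <= b)%N
      & fmul (fmul P M) R' = fun i j => ((i == j :> nat) && (i < k)%N)%:R].
Proof.
have [e [e' [eK e'K]]] := enum_bij (erefl #|S|).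
have [h [h' [hK h'K]]] := enum_bij (erefl #|T|).
pose N := \matrix_(i, j) M (e i) (h j).
have sumS (f : S -> F) : \sum_x f x = \sum_i f (e i).
  by rewrite (reindex e) //; exists e' => x _.
have sumT (f : T -> F) : \sum_x f x = \sum_i f (h i).
  by rewrite (reindex h) //; exists h' => x _.
exists #|S|, #|T|, (\rank N), (fun i x => invmx (col_ebase N) i (e' x)),
  (fun x i => col_ebase N (e' x) i), (fun j y => row_ebase N j (h' y)),
  (fun y j => invmx (row_ebase N) (h' y) j).
have Lu := col_ebase_unit N; have Uu := row_ebase_unit N.
split; rewrite ?rank_leq_row ?rank_leq_col //.
- split; apply: funext2 => i j; rewrite /fmul /fone ?sumS.
    have /matrixP/(_ i j) := mulVmx Lu; rewrite !mxE => <-.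
    by apply: eq_bigr => k _; rewrite eK.
  have /matrixP/(_ (e' i) (e' j)) := mulmxV Lu; rewrite !mxE (can_eq e'K) => <-.
  by apply: eq_bigr.
- split; apply: funext2 => i j; rewrite /fmul /fone ?sumT.
    have /matrixP/(_ i j) := mulmxV Uu; rewrite !mxE => <-.
    by apply: eq_bigr => k _; rewrite hK.
  have /matrixP/(_ (h' i) (h' j)) := mulVmx Uu; rewrite !mxE (can_eq h'K) => <-.
  by apply: eq_bigr.
apply: funext2 => i j.
have : invmx (col_ebase N) *m N *m invmx (row_ebase N) = pid_mx (\rank N).
  by rewrite -{2}(mulmx_ebase N) !mulmxA mulVmx // mul1mx mulmxK.
move/matrixP/(_ i j); rewrite [in RHS]mxE => <-; rewrite /fmul sumT mxE.
apply: eq_bigr => k _; rewrite hK; congr (_ * _); rewrite sumS mxE.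
by apply: eq_bigr => l _; rewrite eK mxE.
Qed.

(** Leastness of the cell [(s, t)]: any nonzero entry outside it has a row of rank above [s] or a
    column of rank above [t], which is where operations starting from the cell may act. *)
Definition zero_below s t (I : finType) (r c : I -> nat) (d : I -> I -> F) :=
  forall i j, (r i <= s)%N -> (c j <= t)%N -> (r i != s) || (c j != t) -> d i j = 0.

Section Conj.
Variables (Q : mxpred F) (Qcl : closed Q) (I J : finType).
Variables (r c : I -> nat) (d : I -> I -> F) (r' c' : J -> nat).
Variables (P : J -> I -> F) (P' : I -> J -> F).
Hypotheses (PP' : fmul P P' = @fone F J) (P'P : fmul P' P = @fone F I).
Hypotheses (Pc : compat r' c' r c P) (P'c : compat r c r' c' P').

Lemma cl_conj : Q r c d -> Q r' c' (fmul (fmul P d) P').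
Proof. by move=> Qd; apply: (cl_sim Qcl Qd PP' P'P Pc P'c); rewrite -fmulA P'P fmul1r. Qed.

Lemma zero_below_conj s t : zero_below s t r c d -> zero_below s t r' c' (fmul (fmul P d) P').
Proof.
move=> z i j ri cj ij; rewrite /fmul big1 // => y _.
have [->|/P'c[_ cy]] := eqVneq (P' y j) 0; first by rewrite mulr0.
rewrite big1 ?mul0r // => x _.
have [->|/Pc[rx _]] := eqVneq (P i x) 0; first by rewrite mul0r.
by rewrite z ?mulr0 // -?rx ?cy.
Qed.

End Conj.

Lemma split_bij (X : finType) (p : pred X) :
  exists (f : {x | p x} + {x | ~~ p x} -> X) g,
    [/\ cancel f g, cancel g f, forall x, f (inl x) = val x & forall x, f (inr x) = val x].
Proof.
pose f (x : {x | p x} + {x | ~~ p x}) := match x with inl x => val x | inr x => val x end.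
pose g x : {x | p x} + {x | ~~ p x} := match boolP (p x) with
  | AltTrue h => inl (Sub x h) | AltFalse h => inr (Sub x h) end.
exists f, g; split=> // [[x|x]|x]; rewrite /g; case: {-}_ / boolP => h //=.
- by congr inl; apply: val_inj.
- by have := valP x; rewrite (negPf h).
- by have := valP x; rewrite h.
- by congr inr; apply: val_inj.
Qed.

Definition sumr (X Y : Type) (n : nat) (f : Y -> nat) (x : X + Y) : nat :=
  match x with inl _ => n | inr y => f y end.

Lemma sum_compat (X Y O O' : Type) s t (rO cO : O -> nat) (rO' cO' : O' -> nat)
    (P : Y -> X -> F) (A : O' -> O -> F) : compat rO' cO' rO cO A ->
  compat (sumr s rO') (sumr t cO') (sumr s rO) (sumr t cO) (blockd P A).
Proof. by move=> Ac [i|i] [j|j] //=; rewrite ?eqxx // => /Ac. Qed.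

Lemma fone_compat (O : finType) (r c : O -> nat) : compat r c r c (@fone F O).
Proof. by move=> i j; rewrite /fone; case: (i =P j) => [->|_] //; rewrite eqxx. Qed.

(** Base change by [P] in the class of the rows of the cell and by [A] on the other indices. Only
    the two blocks in the rows of that class are recorded, since the cell lies in one of them. *)
Lemma block_conj (Q : mxpred F) s u t (X Y O O' : finType) (rO cO : O -> nat)
    (rO' cO' : O' -> nat) (d : X + O -> X + O -> F)
    (P : Y -> X -> F) (P' : X -> Y -> F) (A : O' -> O -> F) (A' : O -> O' -> F) :
  closed Q -> Q _ (sumr s rO) (sumr u cO) d -> zero_below s t (sumr s rO) (sumr u cO) d ->
  fmul P P' = @fone F _ -> fmul P' P = @fone F _ ->
  fmul A A' = @fone F _ -> fmul A' A = @fone F _ ->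
  compat rO' cO' rO cO A -> compat rO cO rO' cO' A' ->
  exists e, [/\ Q (Y + O')%type (sumr s rO') (sumr u cO') e,
    zero_below s t (sumr s rO') (sumr u cO') e,
    forall i j, e (inl i) (inl j) = fmul (fmul P (fun x y => d (inl x) (inl y))) P' i j
  & forall i j, e (inl i) (inr j) = fmul (fmul P (fun x y => d (inl x) (inr y))) A' i j].
Proof.
move=> Qcl Qd z PP' P'P AA' A'A Ac A'c.
have B1 : fmul (blockd P A) (blockd P' A') = @fone F _ by rewrite blockd_mul AA' PP' blockd1.
have B2 : fmul (blockd P' A') (blockd P A) = @fone F _ by rewrite blockd_mul A'A P'P blockd1.
have Bc : compat (sumr s rO') (sumr u cO') (sumr s rO) (sumr u cO) (blockd P A).
  exact: sum_compat.
have Bc' : compat (sumr s rO) (sumr u cO) (sumr s rO') (sumr u cO') (blockd P' A').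
  exact: sum_compat.
exists (fmul (fmul (blockd P A) d) (blockd P' A')); split.
- exact: cl_conj B1 B2 Bc Bc' Qd.
- have z' := zero_below_conj Bc Bc' z; exact: z'.
- move=> i j; rewrite /fmul big_sumType /= [X in _ + X]big1 ?addr0 => [|? _]; last first.
    by rewrite mulr0.
  apply: eq_bigr => y _; rewrite big_sumType /= [X in _ + X]big1 ?addr0 // => o _.
  by rewrite mul0r.
move=> i j; rewrite /fmul big_sumType /= [X in X + _]big1 ?add0r => [|? _]; last first.
  by rewrite mulr0.
apply: eq_bigr => y _; rewrite big_sumType /= [X in _ + X]big1 ?addr0 // => o _.
by rewrite mul0r.
Qed.

Lemma fone_neq0 (O : finType) (i j : O) : @fone F O i j != 0 -> i = j.
Proof. by rewrite /fone; case: (i =P j) => // _; rewrite eqxx. Qed.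

(** An invertible block [b] is a direct summand of the cell. *)
Definition band_form (Q : mxpred F) s t (I : finType) :=
  exists m b b' (Y : finType) rY cY (e : 'I_m.+1 + Y -> 'I_m.+1 + Y -> F),
    [/\ fmul b b' = @fone F 'I_m.+1 /\ fmul b' b = @fone F 'I_m.+1,
        forall i j : 'I_m.+1, (i < m)%N -> b i j = (j == i.+1 :> nat)%:R,
        Q _ (sumr s rY) (sumr t cY) e /\ zero_below s t (sumr s rY) (sumr t cY) e,
        [/\ forall i j, e (inl i) (inl j) = b i j,
            forall i y, cY y = t -> e (inl i) (inr y) = 0
          & forall y i, rY y = s -> e (inr y) (inl i) = 0]
      & #|I| = (m.+1 + #|Y|)%N].

(** The cell is a partial matching. The existence of a link in the last clause is what makes the
    merged problem smaller. *)
Definition shift_form (Q : mxpred F) s t (I : finType) :=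
  exists (E K : finType) hd dp m el r c e,
    [/\ @chain_struct E K hd dp m el, Q E r c e /\ zero_below s t r c e,
        forall x y, r x = s -> c y = t -> e x y = shift F hd dp x y,
        forall x y, shift F hd dp x y != 0 -> r x = s /\ c y = t
      & #|I| = #|E| /\ exists x y, shift F hd dp x y != 0].

(** Rows and columns of the cell form one class, so the cell is a square matrix up to similarity. *)
Lemma cell_same (Q : mxpred F) s t (I : finType) r c (d : I -> I -> F) i0 j0 :
  closed Q -> Q I r c d -> zero_below s t r c d -> r i0 = s -> c i0 = t -> c j0 = t ->
  d i0 j0 != 0 -> band_form Q s t I \/ shift_form Q s t I.
Proof.
move=> Qcl Qd z r0 c0 cj0 dij.
have cls x : (r x == s) = (c x == t) by rewrite -r0 -c0 (cl_class Qcl Qd).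
have [f [g [fK gK fl fr]]] := split_bij (fun x => r x == s).
pose O := {x | r x != s}; pose rO (o : O) := r (val o); pose cO (o : O) := c (val o).
have rs x : r (f x) = sumr s rO x by case: x => x /=; rewrite ?fl ?fr //; apply/eqP/(valP x).
have ct x : c (f x) = sumr t cO x.
  by case: x => x /=; rewrite ?fl ?fr //; apply/eqP; rewrite -cls; apply: (valP x).
have := cl_reindex Qcl fK gK Qd.
rewrite (_ : r \o f = sumr s rO); last exact/functional_extensionality/rs.
rewrite (_ : c \o f = sumr t cO); last exact/functional_extensionality/ct.
pose d1 i j := d (f i) (f j) => Qd1.
have z1 : zero_below s t (sumr s rO) (sumr t cO) d1.
  by move=> i j; rewrite -rs -ct; apply: z.
have cardI : #|I| = #|{: {x | r x == s} + O}| by apply: bij_eq_card; exists f.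
pose p x y := d1 (inl x) (inl y).
have p0 : exists x y, p x y != 0.
  have j0s : r j0 == s by rewrite cls cj0.
  by exists (Sub i0 (introT eqP r0)), (Sub j0 j0s); rewrite /p /d1 !fl.
have cO0 (o : O) : cO o != t by rewrite /cO -cls; apply: (valP o).
have [[m [b [b' [Y [h [bb' b'b bE sm]]]]]]|[E [K [hd [dp [m [el [ch sm]]]]]]]] :=
  band_or_shift p.
  left; have := sim_card sm; case: sm => P [P' [PP' P'P Pp]] cardS.
  have [e [Qe ze eE _]] := block_conj Qcl Qd1 z1 PP' P'P (fmul1l _) (fmul1l _)
    (@fone_compat O _ _) (@fone_compat O _ _).
  have {}eE i j : e (inl i) (inl j) = blockd b h i j.
    by rewrite eE -/p Pp -fmulA PP' fmul1r.
  pose a (x : 'I_m.+1 + (Y + O)) : ('I_m.+1 + Y) + O :=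
    match x with inl i => inl (inl i) | inr (inl y) => inl (inr y) | inr (inr o) => inr o end.
  pose a' (x : ('I_m.+1 + Y) + O) : 'I_m.+1 + (Y + O) :=
    match x with inl (inl i) => inl i | inl (inr y) => inr (inl y) | inr o => inr (inr o) end.
  have aK : cancel a a' by do 2?case.
  have a'K : cancel a' a by do 2?case.
  have := cl_reindex Qcl aK a'K Qe.
  rewrite (_ : sumr s rO \o a = sumr s (sumr s rO)); last first.
    by apply: functional_extensionality; do 2?case.
  rewrite (_ : sumr t cO \o a = sumr t (sumr t cO)); last first.
    by apply: functional_extensionality; do 2?case.
  pose e2 i j := e (a i) (a j) => Qe2.
  exists m, b, b', (Y + O)%type, (sumr s rO), (sumr t cO), e2; split=> //.
  - split=> // i j; rewrite /e2.
    by have := ze (a i) (a j); case: i => [i|[i|i]]; case: j => [j|[j|j]].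
  - split=> [i j|i [y|o]|[y|o] i] //=; rewrite /e2 /= ?eE //.
      by move=> /eqP; rewrite (negPf (cO0 o)).
    by move=> /eqP; rewrite (negPf (valP o)).
  by rewrite cardI !card_sum cardS card_sum card_ord addnA.
right; have := sim_card sm; case: sm => P [P' [PP' P'P Pp]] cardS.
have [e [Qe ze eE _]] := block_conj Qcl Qd1 z1 PP' P'P (fmul1l _) (fmul1l _)
  (@fone_compat O _ _) (@fone_compat O _ _).
have {}eE i j : e (inl i) (inl j) = shift F hd dp i j.
  by rewrite eE -/p Pp -fmulA PP' fmul1r.
pose hd' (x : E + O) : K + O := match x with inl x => inl (hd x) | inr o => inr o end.
pose dp' (x : E + O) := match x with inl x => dp x | inr o => 0%N end.
pose m' (x : K + O) := match x with inl x => m x | inr o => 0%N end.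
pose el' (x : K + O) q : E + O := match x with inl x => inl (el x q) | inr o => inr o end.
have sE : shift F hd' dp' = blockd (shift F hd dp) (fun _ _ => 0).
  by apply: funext2 => -[i|i] [j|j] //=; rewrite /shift /= andbF.
exists (E + O)%type, (K + O)%type, hd', dp', m', el', (sumr s rO), (sumr t cO), e.
rewrite sE; split=> //.
- have [dpm elK hdE] := ch; split=> [[x|x]|[x|x]|[k|o] q qm] //=.
  + by rewrite elK.
  + by have [-> ->] := hdE _ _ qm.
  + by move: qm; rewrite leqn0 => /eqP->.
- move=> [x|x] [y|y] //=; rewrite ?eE //.
  + by move=> _ /eqP; rewrite (negPf (cO0 y)).
  + by move=> /eqP; rewrite (negPf (valP x)).
  + by move=> /eqP; rewrite (negPf (valP x)).
- by move=> [x|x] [y|y] //=; rewrite eqxx.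
split; first by rewrite cardI !card_sum cardS.
have [x [y pxy]] := p0; suff [u [v uv]] : exists u v, shift F hd dp u v != 0.
  by exists (inl u), (inl v).
have : p x y = fmul (fmul P' (shift F hd dp)) P x y.
  by rewrite -fmulA -Pp fmulA P'P fmul1l.
have [/existsP[u /existsP[v uv]]|] := boolP [exists u, exists v, shift F hd dp u v != 0].
  by exists u, v.
move=> /existsPn H; have s0 u v : shift F hd dp u v = 0.
  by have /existsPn/(_ v) := H u; rewrite negbK => /eqP.
rewrite /fmul big1 => [p00|v _]; first by rewrite p00 eqxx in pxy.
by rewrite big1 ?mul0r // => u _; rewrite s0 mulr0.
Qed.

(** Rows and columns of the cell form two classes, so the rank is its only invariant and no chain
    has more than two elements. *)
Lemma cell_diff (Q : mxpred F) s t (I : finType) r c (d : I -> I -> F) i0 j0 :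
  closed Q -> Q I r c d -> zero_below s t r c d -> r i0 = s -> c j0 = t -> c i0 <> t ->
  d i0 j0 != 0 -> shift_form Q s t I.
Proof.
move=> Qcl Qd z r0 cj0 c0 dij; set u := c i0 in c0 *.
have cls x : r x = s -> c x = u.
  by move=> rx; have := cl_class Qcl Qd x i0; rewrite rx r0 eqxx => /esym/eqP.
have [f1 [g1 [f1K g1K f1l f1r]]] := split_bij (fun x => r x == s).
pose S := {x | r x == s}; pose O1 := {x | r x != s}.
have [f2 [g2 [f2K g2K f2l f2r]]] := split_bij (fun x : O1 => c (val x) == t).
pose T := {x : O1 | c (val x) == t}; pose O := {x : O1 | c (val x) != t}.
pose f (x : S + (T + O)) : I := match x with inl x => val x | inr x => val (f2 x) end.
pose g (x : I) : S + (T + O) := match g1 x with inl x => inl x | inr x => inr (g2 x) end.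
have fK : cancel f g.
  move=> [x|x]; rewrite /g /f -?f1l -?f1r f1K //.
  by rewrite f2K.
have gK : cancel g f.
  move=> x; rewrite /g /f -[RHS]g1K; case: (g1 x) => y; first by rewrite f1l.
  by rewrite g2K f1r.
pose rO (x : T + O) := r (val (f2 x)); pose cO (x : T + O) := c (val (f2 x)).
have rs x : r (f x) = sumr s rO x by case: x => x //=; apply/eqP/(valP x).
have ct x : c (f x) = sumr u cO x.
  by case: x => x //=; apply: cls; apply/eqP/(valP x).
have := cl_reindex Qcl fK gK Qd.
rewrite (_ : r \o f = sumr s rO); last exact/functional_extensionality/rs.
rewrite (_ : c \o f = sumr u cO); last exact/functional_extensionality/ct.
pose d1 i j := d (f i) (f j) => Qd1.
have z1 : zero_below s t (sumr s rO) (sumr u cO) d1.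
  by move=> i j; rewrite -rs -ct; apply: z.
have cardI : #|I| = #|{: S + (T + O)}| by apply: bij_eq_card; exists f.
have j0s : r j0 != s by apply/eqP => /cls; rewrite cj0; apply: nesym.
have j0t : c (val (Sub j0 j0s : O1)) == t by apply/eqP.
have [x0 [y0 p0]] : exists (x : S) (y : T), d1 (inl x) (inr (inl y)) != 0.
  by exists (Sub i0 (introT eqP r0)), (Sub (Sub j0 j0s) j0t); rewrite /d1 /= f2l.
pose M (x : S) (y : T) := d1 (inl x) (inr (inl y)).
have [a [b [k [P [P' [R [R' [[PP' P'P] [RR' R'R] ka kb PMR]]]]]]]] := rank_form M.
have rcT (y : T) : rO (inl y) = r j0 /\ cO (inl y) = t.
  rewrite /rO /cO f2l; have /eqP cy := valP y; split=> //.
  by apply/eqP; rewrite (cl_class Qcl Qd) cy cj0.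
have [] := @block_conj Q s u t _ _ _ ('I_b + O)%type rO cO (sumr (r j0) (rO \o inr))
  (sumr t (cO \o inr)) d1 P P' (blockd R (@fone F O)) (blockd R' (@fone F O)) => //.
- by rewrite blockd_mul RR' fmul1l blockd1.
- by rewrite blockd_mul R'R fmul1l blockd1.
- by move=> [i|i] [j|j] /=; rewrite ?eqxx //; [case: (rcT j) => -> -> | move=> /fone_neq0->].
- move=> [i|i] [j|j] /=; rewrite ?eqxx //.
  by move=> /fone_neq0->.
move=> e [Qe ze _ eE].
have {}eE i j : e (inl i) (inr (inl j)) = ((i == j :> nat) && (i < k)%N)%:R.
  rewrite eE; have := congr1 (fun h => h i j) PMR; rewrite /= => <-.
  rewrite {1}/fmul big_sumType /= [X in _ + X]big1 ?addr0 // => y _.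
  by rewrite mulr0.
pose K := ('I_a + ({j : 'I_b | (k <= j)%N} + O))%type.
have k0 : (0 < k)%N.
  rewrite lt0n; apply: contraNneq p0 => k0.
  have -> : d1 (inl x0) (inr (inl y0)) = fmul (fmul P' (fmul (fmul P M) R')) R x0 y0.
    by rewrite !fmulA P'P fmul1l -fmulA R'R fmul1r.
  rewrite PMR /fmul big1 // => j _; rewrite big1 ?mul0r // => i _.
  by rewrite k0 ltn0 andbF mulr0.
(* A default value for [insubd] that is never reached: column [j < k] joins row [j], which exists
   because [k <= a]. *)
pose a0 : 'I_a := Ordinal (leq_trans k0 ka).
pose hd (x : 'I_a + ('I_b + O)) : K := match x with
  | inl i => inl i
  | inr (inl j) => if insub j is Some j' then inr (inl j') else inl (insubd a0 (val j))
  | inr (inr o) => inr (inr o) end.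
have hdge (j : {j : 'I_b | (k <= j)%N}) : hd (inr (inl (val j))) = inr (inl j).
  by rewrite /hd valK.
have hdlt (j : 'I_b) : (j < k)%N -> exists2 i : 'I_a, hd (inr (inl j)) = inl i & i = j :> nat.
  move=> jk; exists (insubd a0 (val j)); first by rewrite /hd insubN // -ltnNge.
  by rewrite val_insubd (leq_trans jk ka).
pose dp (x : 'I_a + ('I_b + O)) : nat := if x is inr (inl j) then (j < k)%N else 0%N.
pose m (x : K) : nat := if x is inl i then (i < k)%N else 0%N.
pose el (x : K) q : 'I_a + ('I_b + O) := match x with
  | inl i => if q is 0 then inl i else
      if insub (val i) is Some j then inr (inl j) else inl i
  | inr (inl j) => inr (inl (val j)) | inr (inr o) => inr (inr o) end.
have sE i j : shift F hd dp i j =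
  if (i, j) is (inl i, inr (inl j)) then ((i == j :> nat) && (i < k)%N)%:R else 0.
  rewrite /shift.
  case: j => [j|[j|j]]; try by rewrite /= andbF; case: i.
  have [jk|jk] := ltnP j k; last first.
    rewrite /= ltnNge jk andbF; case: i => // i.
    by have -> : (i == j :> nat) && (i < k)%N = false by lia.
  have [i' -> ij] := hdlt j jk; rewrite /= jk.
  case: i => [i|[i|i]] /=; last by [].
    rewrite (_ : (inl i == _) = (i == j :> nat)).
      by congr (nat_of_bool _)%:R; lia.
    by rewrite -ij; apply/eqP/eqP => [[->]|/val_inj->].
  have [ik|ik] := ltnP i k; first by rewrite andbF.
  by have := hdge (Sub i ik); rewrite /hd /= => ->.
exists ('I_a + ('I_b + O))%type, K, hd, dp, m, el.
exists (sumr s (sumr (r j0) (rO \o inr))), (sumr u (sumr t (cO \o inr))), e.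
have cO0 (o : O) : (cO \o inr) o <> t.
  by rewrite /= /cO f2r; apply/eqP/(valP o).
split=> //.
- split=> [[i|[j|o]]|[i|[j|o]]|[i|[j|o]] q qm] //.
  + have [jk|jk] := ltnP j k; last by rewrite /= ltnNge jk.
    by have [i -> /= ->] := hdlt j jk.
  + have [jk|jk] := ltnP j k; last by rewrite (hdge (Sub j jk)).
    have [i -> ij] := hdlt j jk; rewrite /= jk.
    by case: insubP => [j' _ jE|]; [congr (inr (inl _)); apply: val_inj; rewrite jE | rewrite /= ij ltn_ord].
  + case: q qm => [|[|q]] //=; last by lia.
    move=> ik; have ik' : (i < k)%N by lia.
    case: insubP => [j' _ jE|]; last by rewrite /= (leq_trans ik' kb).
    rewrite /= jE ik'; split=> //; rewrite insubN; last by rewrite jE -ltnNge.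
    by congr inl; apply: val_inj; rewrite val_insubd ltn_ord.
  + move: qm; rewrite leqn0 => /eqP->; rewrite hdge; split=> //=.
    by have := valP j; rewrite /= ltnNge => ->.
  by move: qm; rewrite leqn0 => /eqP->.
- move=> [i|x] [j|[j|o]]; rewrite sE /=.
  + by move=> _ /c0.
  + by rewrite eE.
  + by move=> _ /cO0.
  + by move=> _ /c0.
  + case: x => [i|o] /= rs'; first by have := j0s; rewrite rs' eqxx.
    by move: rs'; rewrite /rO f2r => /eqP; rewrite (negPf (valP (val o))).
  + by move=> _ /cO0.
- by move=> [i|x] [j|[j|o]]; rewrite sE ?eqxx.
split; first by rewrite cardI !card_sum !card_ord (fmul_card P'P PP') (fmul_card R'R RR') !card_ord.
exists (inl (Ordinal (leq_trans k0 ka))), (inr (inl (Ordinal (leq_trans k0 kb)))).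
by rewrite sE /= k0 oner_eq0.
Qed.

End CellNormalForm.

(** * Reduction to chain form *)

Section ChainForm.
Variable F : fieldType.

Definition link (I : finType) (d : I -> I -> F) x y := [forall z, d x z == (z == y)%:R].

Lemma linkP (I : finType) (d : I -> I -> F) x y :
  reflect (forall z, d x z = (z == y)%:R) (link d x y).
Proof. by apply: (iffP forallP) => H z; apply/eqP/H. Qed.

(** The row of the last member of a list is free except that its support stays in the list. *)
Definition chain_form (I : finType) (d : I -> I -> F) (cs : seq (seq I)) :=
  [/\ uniq (flatten cs), forall x, x \in flatten cs
    & forall s, s \in cs -> [/\ s != [::], sorted (link d) s &
        forall x y, x \in s -> y \notin s -> d x y = 0]].

(** * Splitting off an invertible block *)

Section Banded.
Variables (Q : mxpred F) (s t m : nat) (b : 'I_m.+1 -> 'I_m.+1 -> F).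

Definition banded : mxpred F := fun K r c d =>
  @Q ('I_m.+1 + K)%type (sumr s r) (sumr t c) (blockd b d).

Lemma banded_closed : closed Q -> closed banded.
Proof.
move=> Qcl; split.
- by move=> I r c d Qd i j; apply: (cl_class Qcl Qd (inr i) (inr j)).
- move=> I r c d k l a Qd lk.
  have := cl_row Qcl (k := inr k) (l := inr l) a Qd lk; congr Q.
  by apply: funext2 => -[i|i] [j|j] //=; rewrite ?(mul0r, mulr0, addr0).
- move=> I r c d k l a Qd lk.
  have := cl_col Qcl (k := inr k) (l := inr l) a Qd lk; congr Q.
  by apply: funext2 => -[i|i] [j|j] //=; rewrite ?(mul0r, mulr0, addr0).
move=> I J r c d r' c' e P P' Qd PP' P'P Pc P'c Pde.
apply: (cl_sim Qcl (P := blockd (@fone F _) P) (P' := blockd (@fone F _) P') Qd).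
- by rewrite blockd_mul fmul1l PP' blockd1.
- by rewrite blockd_mul fmul1l P'P blockd1.
- exact: sum_compat.
- exact: sum_compat.
by rewrite !blockd_mul fmul1l fmul1r Pde.
Qed.

(** As [b] is invertible, its rows clear the entries below it and its columns the entries beside it.
    By leastness of the cell those entries lie in rows of rank above [s], respectively in columns of
    rank above [t], so the operations are admissible. *)
Lemma banded_clear b' (K : finType) rK cK (e : 'I_m.+1 + K -> 'I_m.+1 + K -> F) :
  closed Q -> fmul b b' = @fone F _ -> fmul b' b = @fone F _ ->
  Q (sumr s rK) (sumr t cK) e -> zero_below s t (sumr s rK) (sumr t cK) e ->
  (forall i j, e (inl i) (inl j) = b i j) ->
  (forall i y, cK y = t -> e (inl i) (inr y) = 0) ->
  (forall y i, rK y = s -> e (inr y) (inl i) = 0) ->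
  exists d, banded rK cK d.
Proof.
move=> Qcl bb' b'b Qe z eb et es.
pose N (x y : 'I_m.+1 + K) := if (x, y) is (inr x, inl i)
  then - \sum_j e (inr x) (inl j) * b' j i else 0.
pose e1 x y := e x y + fmul N e x y.
have Q1 : Q (sumr s rK) (sumr t cK) e1.
  apply: (cl_rowblock Qcl (s := s)) => // -[i|x] [l|y] //=; rewrite ?eqxx //.
  move=> N0; split=> //; rewrite ltnNge; apply: contraNN N0 => xs.
  rewrite /N /= big1 ?oppr0 // => j _; have [/es->|ns] := eqVneq (rK x) s; first by rewrite mul0r.
  by rewrite z ?mul0r //= ns.
have e1l i : e1 (inl i) = e (inl i).
  by apply: functional_extensionality => y; rewrite /e1 /fmul big1 ?addr0 // => -[k|k] _; rewrite mul0r.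
have e1r x j : e1 (inr x) (inl j) = 0.
  rewrite /e1 /fmul big_sumType /= [X in _ + (_ + X)]big1 ?addr0 => [|k _]; last by rewrite mul0r.
  apply/eqP; rewrite addr_eq0; apply/eqP.
  have := congr1 (fun h => fmul (fun (_ : unit) j => e (inr x) (inl j)) h tt j) b'b.
  rewrite fmul1r fmulA => <-; rewrite /fmul -sumrN; apply: eq_bigr => i _.
  by rewrite eb mulNr opprK.
pose N2 (x y : 'I_m.+1 + K) := if (x, y) is (inl j, inr y)
  then - \sum_i b' j i * e1 (inl i) (inr y) else 0.
have := cl_colblock Qcl (t := t) (N := N2) Q1.
pose e2 x y := e1 x y + fmul e1 N2 x y.
rewrite -/e2 => Q2; exists (fun x y => e2 (inr x) (inr y)); rewrite /banded.
rewrite (_ : blockd b _ = e2).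
  apply: Q2 => -[l|l] [j|y] //=; rewrite ?eqxx // => N0; split=> //.
  rewrite ltnNge; apply: contraNN N0 => yt.
  rewrite /N2 /= big1 ?oppr0 // => i _; rewrite e1l.
  have [/et->|nt] := eqVneq (cK y) t; first by rewrite mulr0.
  by rewrite z ?mulr0 //= nt orbT.
apply: funext2 => -[i|x] [j|y] //=; rewrite /e2 /fmul big_sumType /=.
- by rewrite !big1 ?addr0 ?e1l ?eb // => k _; rewrite mulr0.
- rewrite [X in _ + (_ + X)]big1 ?addr0 => [|k _]; last by rewrite mulr0.
  apply/esym/eqP; rewrite addr_eq0; apply/eqP.
  have := congr1 (fun h => fmul h (fun i (_ : unit) => e1 (inl i) (inr y)) i tt) bb'.
  rewrite fmul1l -fmulA => <-; rewrite /fmul -sumrN; apply: eq_bigr => k _.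
  by rewrite e1l eb mulrN opprK.
by rewrite !big1 ?addr0 ?e1r // => k _; rewrite mulr0.
Qed.

Lemma banded_chain (K : finType) (d : K -> K -> F) cs :
  (forall i j : 'I_m.+1, (i < m)%N -> b i j = (j == i.+1 :> nat)%:R) ->
  chain_form d cs ->
  chain_form (blockd b d) ([seq inl i | i <- enum 'I_m.+1] :: map (map inr) cs).
Proof.
move=> bE [ucs mcs csP].
have fl : flatten (map (map inr) cs) = map (@inr 'I_m.+1 K) (flatten cs) by rewrite map_flatten.
split=> /=; rewrite ?fl.
- rewrite cat_uniq map_inj_uniq ?enum_uniq => [|? ? []//].
  rewrite map_inj_uniq ?ucs ?andbT => [|? ? []//].
  by apply/hasPn => _ /mapP[x _ ->]; apply/mapP => -[].
- case=> x; rewrite mem_cat ?fl; first by rewrite map_f ?mem_enum.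
  by rewrite [X in _ || X]map_f ?orbT.
move=> u; rewrite inE => /orP[/eqP->|/mapP[v /csP[v0 sv vP] ->]].
  split.
  - by rewrite -size_eq0 size_map size_enum_ord.
  - rewrite sorted_map; apply/(sortedP ord0) => i; rewrite size_enum_ord => im /=.
    have im' : (i < m.+1)%N := ltnW im.
    apply/linkP => -[z|z] //=; rewrite bE !nth_enum_ord //.
    congr (nat_of_bool _)%:R; apply/eqP/eqP => [zE|[->]]; last by rewrite nth_enum_ord.
    by congr inl; apply: val_inj; rewrite /= nth_enum_ord.
  by move=> x [y|y] /mapP[i _ ->] //; rewrite map_f ?mem_enum.
split.
- by case: v {sv vP} v0.
- by rewrite sorted_map; apply: sub_sorted sv => x y /linkP xy; apply/linkP => -[z|z] /=.
move=> _ y /mapP[x xv ->]; case: y => [y|y] //= yv; apply: vP => //.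
by apply: contra yv => yv; rewrite map_f.
Qed.

End Banded.

(** * From lists of chains back to lists of elements *)

Section Expand.
Variables (E K : finType) (hd : E -> K) (dp : E -> nat) (m : K -> nat) (el : K -> nat -> E).
Hypothesis ch : chain_struct hd dp m el.

Definition expand (s : seq K) : seq E := [seq el k q | k <- s, q <- iota 0 (m k).+1].

Lemma mem_expand s x : (x \in expand s) = (hd x \in s).
Proof.
have [dpm elK hdE] := ch; apply/allpairsPdep/idP => [[k [q [ks]]]|xs].
  by rewrite mem_iota ltnS => /hdE[hk _] ->; rewrite hk.
by exists (hd x), (dp x); rewrite mem_iota ltnS elK dpm.
Qed.

Lemma uniq_expand s : uniq s -> uniq (expand s).
Proof.
have [dpm elK hdE] := ch => us.
apply: allpairs_uniq_dep => // [k _|x y]; first exact: iota_uniq.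
case/allpairsPdep => k [q [ks]]; rewrite mem_iota ltnS => /hdE[hk dk] ->.
case/allpairsPdep => k' [q' [ks']]; rewrite mem_iota ltnS => /hdE[hk' dk'] -> /= xyE.
by move: hk dk; rewrite xyE hk' dk' => <- <-.
Qed.

(** Inside a chain the links are those of the shift; at its end, the unit row of [d] leads to the
    beginning of the next chain. *)
Lemma expand_chain d s : sorted (link d) s -> sorted (link (chain_ext hd dp m d)) (expand s).
Proof.
have [dpm elK hdE] := ch; have e0 k : el k 0%N :: [seq el k q | q <- iota 1 (m k)] =
  [seq el k q | q <- iota 0 (m k).+1] by [].
have pathk k n q : (q + n <= m k)%N ->
    path (link (chain_ext hd dp m d)) (el k q) [seq el k q | q <- iota q.+1 n] /\
    last (el k q) [seq el k q | q <- iota q.+1 n] = el k (q + n)%N.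
  elim: n q => [|n IHn] q qn /=; first by rewrite addn0.
  have [|-> ->] := IHn q.+1; first by rewrite addSnnS.
  rewrite addSnnS andbT; split=> //; apply/linkP => z.
  by rewrite (chain_ext_mid ch) //; lia.
case: s => [|k s] //= ks; rewrite /expand /= cat_path.
have [pk ->] := pathk k (m k) 0%N (leqnn _); rewrite pk /= add0n {pk}.
elim: s k ks => //= l s IHs k /andP[/linkP kl ls]; rewrite /= cat_path.
have [pl ll] := pathk l (m l) 0%N (leqnn _); rewrite ll pl /= IHs // andbT.
by apply/linkP => z; rewrite (chain_ext_end ch) kl (eq_el ch) // bool_mulr andbC.
Qed.

Lemma expand_form d cs :
  chain_form d cs -> chain_form (chain_ext hd dp m d) (map expand cs).
Proof.
case=> ucs mcs csP.
have fl : flatten (map expand cs) = expand (flatten cs).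
  rewrite /expand; elim: cs {ucs mcs csP} => //= c cs ->.
  by rewrite map_cat flatten_cat.
split; first by rewrite fl uniq_expand.
  by move=> x; rewrite fl mem_expand.
move=> _ /mapP[s /csP[s0 ss sP] ->]; split.
- by case: s s0 {ss sP}.
- exact: expand_chain.
move=> x y; rewrite !mem_expand => xs ys; rewrite /chain_ext /shift sP // mulr0 addr0.
by case: eqP => // xy; rewrite -xy xs in ys.
Qed.

End Expand.

(** * Clearing around the links *)

Section ShiftClear.
Variables (Q : mxpred F) (s t : nat).
Variables (E K : finType) (hd : E -> K) (dp : E -> nat) (m : K -> nat) (el : K -> nat -> E).
Hypothesis ch : chain_struct hd dp m el.

(** Each link is a pivot 1. Row operations clear its column in the rows of rank above [s], column
    operations clear its row in the columns of rank above [t]. Besides the links, only entries from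
    the end of a chain to the beginning of a chain survive. *)
Lemma shift_clear r c (e : E -> E -> F) :
  closed Q -> Q r c e -> zero_below s t r c e ->
  (forall x y, r x = s -> c y = t -> e x y = shift F hd dp x y) ->
  (forall x y, shift F hd dp x y != 0 -> r x = s /\ c y = t) ->
  exists w r' c' d, @merged F Q s t w K r' c' d.
Proof.
move=> Qcl Qe z cell shrc; have [dpm elK hdE] := ch.
pose nx y := el (hd y) (dp y).+1; pose pv y := el (hd y) (dp y).-1.
have shx x y : (dp x < m (hd x))%N -> shift F hd dp x y = (y == nx x)%:R.
  by move=> xm; rewrite /shift (eq_el ch) // eq_sym.
have shy x y : (0 < dp y)%N -> shift F hd dp x y = (x == pv y)%:R.
  move=> y0; rewrite /shift (eq_el ch); last by have := dpm y; lia.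
  by congr (nat_of_bool _)%:R; case: (hd x =P hd y) => //= _; lia.
have src x : (dp x < m (hd x))%N -> r x = s.
  by move=> xm; have [|//] := shrc x (nx x); rewrite shx // eqxx oner_eq0.
have tgt y : (0 < dp y)%N -> c y = t.
  by move=> y0; have [|//] := shrc (pv y) y; rewrite shy // eqxx oner_eq0.
have pvm y : (0 < dp y)%N -> (dp (pv y) < m (hd (pv y)))%N.
  move=> y0; have [|-> ->] := hdE (hd y) (dp y).-1; first by have := dpm y; lia.
  by have := dpm y; lia.
have nx0 x : (dp x < m (hd x))%N -> (0 < dp (nx x))%N by move=> xm; have [_ ->] := hdE _ _ xm.
(* Row [y] holds the pivot of column [nx y]. *)
pose N x y := if (dp y < m (hd y))%N && (s < r x)%N then - e x (nx y) else 0.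
pose e1 x y := e x y + fmul N e x y.
have Q1 : Q r c e1.
  apply: (cl_rowblock Qcl (s := s)) => // x y; rewrite /N.
  by case: andP => [[/src]|]; rewrite ?eqxx.
have e1s x : (r x <= s)%N -> e1 x = e x.
  move=> xs; apply: functional_extensionality => y.
  by rewrite /e1 /fmul big1 ?addr0 // => u _; rewrite /N [(s < _)%N]ltnNge xs andbF mul0r.
have e1t x y : (0 < dp y)%N -> e1 x y = shift F hd dp x y.
  move=> y0; have [xs|xs] := leqP (r x) s.
    rewrite e1s //; have [rx|rx] := eqVneq (r x) s; first by rewrite cell ?tgt.
    rewrite z ?rx ?tgt //; apply/esym/eqP; apply: contraR rx => /shrc[-> _].
    by rewrite eqxx.
  have -> : shift F hd dp x y = 0.
    by apply/eqP; apply: contraTT xs => /shrc[-> _]; rewrite ltnn.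
  rewrite /e1 /fmul (bigD1 (pv y)) //= /N (pvm y y0) xs.
  have -> : nx (pv y) = y.
    have [|hp dpp] := hdE (hd y) (dp y).-1; first by have := dpm y; lia.
    by rewrite /nx /pv hp dpp prednK.
  rewrite /= mulNr [e (pv y) y]cell ?(src _ (pvm y y0)) ?tgt // shy // eqxx mulr1 addrA subrr add0r.
  rewrite big1 // => u upv; case: ifP => [/andP[um _]|_]; last by rewrite mul0r.
  by rewrite [e u y]cell ?src ?tgt // shy // (negPf upv) mulr0.
(* Row [pv x] holds the pivot of column [x]; it is intact, since the row operations leave rows of
   rank up to [s] alone. *)
pose N2 x y := if (0 < dp x)%N && (t < c y)%N then - e1 (pv x) y else 0.
have := cl_colblock Qcl (t := t) (N := N2) Q1.
pose e2 x y := e1 x y + fmul e1 N2 x y; rewrite -/e2 => Q2.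
have {}Q2 : Q r c e2.
  by apply: Q2 => x y; rewrite /N2; case: andP => [[/tgt]|]; rewrite ?eqxx.
have e2s x y : (c y <= t)%N -> e2 x y = e1 x y.
  by move=> yt; rewrite /e2 /fmul big1 ?addr0 // => u _; rewrite /N2 [(t < _)%N]ltnNge yt andbF mulr0.
have e2t x y : (0 < dp y)%N -> e2 x y = shift F hd dp x y.
  by move=> y0; rewrite e2s ?tgt // e1t.
have e2x x y : (dp x < m (hd x))%N -> e2 x y = shift F hd dp x y.
  move=> xm; have [yt|yt] := leqP (c y) t.
    rewrite e2s // e1s ?src //; have [cy|cy] := eqVneq (c y) t; first by rewrite cell ?src.
    rewrite z ?src ?cy ?orbT //; apply/esym/eqP; apply: contraR cy => /shrc[_ ->].
    by rewrite eqxx.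
  have -> : shift F hd dp x y = 0.
    by apply/eqP; apply: contraTT yt => /shrc[_ ->]; rewrite ltnn.
  rewrite /e2 /fmul (bigD1 (nx x)) //= /N2 (nx0 x xm) yt.
  have -> : pv (nx x) = x.
    by rewrite /pv /nx; have [-> ->] := hdE _ _ xm; rewrite /= elK.
  rewrite /= [e1 x (nx x)]e1t ?nx0 // shx // eqxx mul1r addrA subrr add0r big1 // => u unx.
  case: ifP => [/andP[u0 _]|_]; last by rewrite mulr0.
  by rewrite [e1 x u]e1t // shx // (negPf unx) mul0r.
pose d k l := e2 (el k (m k)) (el l 0%N).
have e2d : e2 = chain_ext hd dp m d.
  apply: funext2 => x y; rewrite /chain_ext.
  case: eqP => [xm|/eqP xm]; last first.
    by rewrite mul0r addr0 e2x // ltn_neqAle xm dpm.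
  case: eqP => [y0|/eqP y0]; last by rewrite mul0r addr0 e2t // lt0n.
  have := elK x; have := elK y; rewrite xm y0 mul1r /d => -> ->.
  by rewrite /shift y0 andbF add0r.
pose w := (\max_k m k).+1.
pose rho k := r (el k (m k)); pose gam k := c (el k 0%N).
exists w, (fun k => pack w (rho k) (m k)), (fun k => pack w (gam k) (m k)), d.
exists E, hd, dp, m, el, rho, gam; split=> //.
- by split=> // k; rewrite /w ltnS leq_bigmax.
- move=> k l rk cl; rewrite /d e2s // e1s //.
  have [_ dl] := hdE l 0%N (leq0n _).
  have sh0 : shift F hd dp (el k (m k)) (el l 0%N) = 0 by rewrite /shift dl andbF.
  have [rs|rs] := eqVneq (rho k) s; last by rewrite z // rs.
  have [cs|cs] := eqVneq (gam l) t; last by rewrite z // cs orbT.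
  by rewrite cell.
rewrite -e2d (_ : ext_row_rank _ _ _ _ _ = r).
  rewrite (_ : ext_col_rank _ _ _ _ = c) //; apply: functional_extensionality => x.
  rewrite /ext_col_rank /gam; case: eqP => [x0|/eqP x0]; last by rewrite tgt // lt0n.
  by have := elK x; rewrite x0 => ->.
apply: functional_extensionality => x; rewrite /ext_row_rank /rho.
case: eqP => [xm|/eqP xm]; last by rewrite src // ltn_neqAle xm dpm.
by have := elK x; rewrite xm => ->.
Qed.

Lemma shift_card x y : shift F hd dp x y != 0 -> (#|K| < #|E|)%N.
Proof.
have [dpm elK hdE] := ch; rewrite /shift => xy.
have elI : injective (fun k => el k 0%N).
  move=> k l /(congr1 hd); have [-> _] := hdE k 0%N (leq0n _).
  by have [-> _] := hdE l 0%N (leq0n _).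
rewrite -(card_codom elI); apply: proper_card; apply/properP; split; first exact/subsetP.
exists y => //; apply/codomP => -[k yE]; move: xy; rewrite yE.
by have [_ ->] := hdE k 0%N (leq0n _); rewrite andbF eqxx.
Qed.

End ShiftClear.

(** The predicate varies in the induction, because each step passes from [Q] to [banded] or
    [merged]. The number of indices drops by the size of the block, or by the number of links. *)
Theorem chain_form_exists (Q : mxpred F) (I : finType) r c (d : I -> I -> F) :
  closed Q -> Q I r c d ->
  exists (J : finType) r' c' (e : J -> J -> F) cs, Q J r' c' e /\ chain_form e cs.
Proof.
have [n] := ubnP #|I|; elim: n Q I r c d => // n IHn Q I r c d /ltnSE cardI Qcl Qd.
have [/existsP[i1 /existsP[j1 dij]]|] := boolP [exists i, exists j, d i j != 0]; last first.
  move=> /existsPn d0; exists I, r, c, d, [seq [:: x] | x <- enum I]; split=> //.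
  have fl : flatten [seq [:: x] | x <- enum I] = enum I by elim: (enum I) => //= x s ->.
  split; [by rewrite fl enum_uniq | by move=> x; rewrite fl mem_enum |].
  move=> s /mapP[x _ ->]; split=> // u v _ _.
  by have /existsPn/(_ v) := d0 u; rewrite negbK => /eqP.
pose rs k := [exists i, exists j, (r i == k) && (d i j != 0)].
have exr : exists k, rs k.
  by exists (r i1); apply/existsP; exists i1; apply/existsP; exists j1; rewrite eqxx.
case: (ex_minnP exr) => s /existsP[i2 /existsP[j2 /andP[/eqP ri2 d2]]] smin.
(* The least row rank is fixed before the least column rank within those rows; this order is what
   gives [zero_below]. *)
pose ct k := [exists i, exists j, [&& r i == s, c j == k & d i j != 0]].
have exc : exists k, ct k.
  exists (c j2); apply/existsP; exists i2; apply/existsP; exists j2.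
  by rewrite ri2 !eqxx.
case: (ex_minnP exc) => t /existsP[i /existsP[j /and3P[/eqP ri /eqP cj d0]]] tmin.
have z : zero_below s t r c d.
  move=> x y rx cy; apply: contraTeq => dxy.
  have rxs : r x = s.
    apply/eqP; rewrite eqn_leq rx /=; apply: smin.
    by apply/existsP; exists x; apply/existsP; exists y; rewrite eqxx.
  have cyt : c y = t.
    apply/eqP; rewrite eqn_leq cy /=; apply: tmin.
    by apply/existsP; exists x; apply/existsP; exists y; rewrite rxs !eqxx.
  by rewrite rxs cyt !eqxx.
have [bd|sh] : band_form Q s t I \/ shift_form Q s t I.
  have [ci|/eqP ci] := eqVneq (c i) t; first exact: (cell_same Qcl Qd z ri ci cj d0).
  by right; apply: (cell_diff Qcl Qd z ri cj ci d0).
- have [m [b [b' [Y [rY [cY [e [[bb' b'b] bE [Qe ze] [eb et es] cI]]]]]]]] := bd.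
  have [d' Qd'] := banded_clear Qcl bb' b'b Qe ze eb et es.
  have [|J [r' [c' [e' [cs [Qe' ecs]]]]]] := IHn _ _ _ _ _ _ (banded_closed s t b Qcl) Qd'.
    by rewrite (leq_trans _ cardI) // cI addSn ltnS leq_addl.
  by do 5!eexists; split; [exact: Qe' | apply: banded_chain ecs].
have [E [K [hd [dp [m [el [r' [c' [e [ch [Qe ze] cell shrc [cI [x [y xy]]]]]]]]]]]]] := sh.
have [w [r1 [c1 [d' Qd']]]] := shift_clear ch Qcl Qe ze cell shrc.
have [|J [r2 [c2 [e' [cs [Qe' ecs]]]]]] := IHn _ _ _ _ _ _ (merged_closed s t w Qcl) Qd'.
  by rewrite (leq_trans _ cardI) // cI (shift_card ch xy).
have [E' [hd' [dp' [m' [el' [rho [gam [ch' _ _ QE]]]]]]]] := Qe'.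
have mcs := expand_form ch' ecs.
by do 5!eexists; split; [exact: QE | exact: mcs].
Qed.

End ChainForm.

(** * Bases of finite abelian groups of exponent a power of p *)

Section Realize.
Variables (V : zmodType) (p N : nat).
Hypotheses (p_pr : prime p) (pN : forall v : V, v *+ p ^ N = 0).

Lemma dvdz_Fp (z : int) : (p %| z)%Z = (z%:~R == 0 :> 'F_p).
Proof.
case: z => n; rewrite ?NegzE ?mulrNz ?oppr_eq0 dvdzE ?abszN -pmulrn;
  exact: (dvdn_pcharf (pchar_Fp p_pr)).
Qed.

Definition lc (I : finType) (x : I -> V) (n : I -> int) := \sum_i x i *~ n i.

Lemma lc_comp (I J : finType) (x : I -> V) (T : J -> I -> int) n :
  lc (fun j => lc x (T j)) n = lc x (fun i => \sum_j T j i * n j).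
Proof.
rewrite /lc; under eq_bigr do rewrite mulrz_suml.
rewrite exchange_big; apply: eq_bigr => i _ /=.
by rewrite mulrz_sumr; apply: eq_bigr => j _; rewrite mulrzA.
Qed.

Lemma lcD (I : finType) (x : I -> V) n n' :
  lc x n + lc x n' = lc x (fun i => n i + n' i).
Proof. by rewrite /lc -big_split; apply: eq_bigr => i _; rewrite mulrzDr. Qed.

Lemma lcM (I : finType) (x : I -> V) n z : lc x n *~ z = lc x (fun i => n i * z).
Proof. by rewrite /lc mulrz_suml; apply: eq_bigr => i _; rewrite mulrzA. Qed.

(** Coefficients are integers, because the modulus [p ^ a i] differs from one basis element to
    another. *)
Definition is_basis (I : finType) (a : I -> nat) (x : I -> V) :=
  [/\ forall i, (0 < a i)%N, forall i, x i *+ p ^ a i = 0,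
      forall v, exists n, v = lc x n
    & forall n, lc x n = 0 -> forall i, ((p ^ a i)%:Z %| n i)%Z].

(** Matrices over the prime field lift to integer matrices that are inverse to each other only
    modulo [p]. Since [p ^ N] kills [V], spanning follows by successive approximation; independence
    follows from the same iteration on the coefficients of a relation. *)
Lemma basis_change (I J : finType) a (x : I -> V) b (T : J -> I -> int) (S : I -> J -> int) :
  is_basis a x -> (forall j, (0 < b j)%N) ->
  (forall j i, ((p ^ a i)%:Z %| (p ^ b j)%:Z * T j i)%Z) ->
  (forall i j, ((p ^ b j)%:Z %| (p ^ a i)%:Z * S i j)%Z) ->
  (forall j k, (p %| \sum_i T j i * S i k - (j == k)%:R)%Z) ->
  (forall i k, (p %| \sum_j S i j * T j k - (i == k)%:R)%Z) ->
  is_basis b (fun j => lc x (T j)).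
Proof.
case=> a0 ax span indep b0 Tab Sab TS ST.
have x0 i z : ((p ^ a i)%:Z %| z)%Z -> x i *~ z = 0.
  by case/dvdzP => q ->; rewrite mulrC mulrzA -pmulrn ax mul0rz.
split=> // [j|v|n yn].
- rewrite pmulrn lcM /lc big1 // => i _; apply: x0.
  by rewrite mulrC.
- pose E i k := ((\sum_j S i j * T j k - (i == k)%:R) %/ p)%Z.
  have EE i k : E i k * p = \sum_j S i j * T j k - (i == k)%:R by apply/divzK/ST.
  have step u : exists n u', u = lc (fun j => lc x (T j)) n + u' *+ p.
    have [m ->] := span u; exists (fun j => \sum_i S i j * m i).
    exists (lc x (fun k => - \sum_i E i k * m i)).
    rewrite pmulrn lcM lc_comp lcD; congr lc; apply: functional_extensionality => i.
    transitivity (\sum_k (k == i)%:R * m k).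
      rewrite (bigD1 i) //= eqxx mul1r big1 ?addr0 // => k /negPf->.
      by rewrite mul0r.
    under [X in _ = X + _]eq_bigr do rewrite big_distrr /=.
    rewrite exchange_big mulNr big_distrl -sumrB /=; apply: eq_bigr => k _.
    rewrite mulrAC EE.
    have -> : \sum_j T j i * (S k j * m k) = (\sum_j S k j * T j i) * m k.
      by rewrite big_distrl; apply: eq_bigr => j _ /=; ring.
    by ring.
  have [n [u ->]] : exists n u, v = lc (fun j => lc x (T j)) n + u *+ p ^ N.
    elim: N => [|k [n [u ->]]].
      by exists (fun=> 0), v; rewrite mulr1n /lc big1 ?add0r.
    have [n' [u' ->]] := step u.
    exists (fun j => n j + n' j * (p ^ k)%:Z), u'.
    by rewrite -lcD -lcM -pmulrn mulrnDl addrA expnS mulrnA.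
  by exists n; rewrite pN addr0.
(* [L] describes the trivial relations, and [M] is the error of [T S] against the identity,
   divisible by [p]. Modulo [L] a relation equals minus its image under [M], hence is congruent to
   multiples of ever higher powers of [p]. *)
pose L (l : J -> int) := forall j, ((p ^ b j)%:Z %| l j)%Z.
pose M j k := \sum_i T j i * S i k - (j == k)%:R.
have LTS l : (forall i, ((p ^ a i)%:Z %| \sum_j T j i * l j)%Z) ->
    L (fun k => l k + \sum_j l j * M j k).
  move=> aT k; have -> : l k + \sum_j l j * M j k = \sum_i (\sum_j T j i * l j) * S i k.
    transitivity (\sum_j (j == k)%:R * l j + \sum_j l j * M j k).
      congr (_ + _); rewrite (bigD1 k) //= eqxx mul1r big1 ?addr0 // => j /negPf->.
      by rewrite mul0r.
    under [RHS]eq_bigr do rewrite big_distrl /=.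
    rewrite exchange_big -big_split; apply: eq_bigr => j _ /=.
    have -> : \sum_i T j i * l j * S i k = (\sum_i T j i * S i k) * l j.
      by rewrite big_distrl; apply: eq_bigr => i _ /=; ring.
    by rewrite /M; ring.
  apply: rpred_sum => i _; case/dvdzP: (aT i) => q ->.
  by rewrite -mulrA dvdz_mull.
have LM l : L l -> L (fun k => \sum_j l j * M j k).
  move=> Ll k; rewrite -(rpredDl _ (Ll k)) ; apply: LTS => i.
  apply: rpred_sum => j _; case/dvdzP: (Ll j) => q ->.
  by rewrite mulrCA dvdz_mull // mulrC.
have n0 i : ((p ^ a i)%:Z %| \sum_j T j i * n j)%Z 
  by apply: (indep (fun i => \sum_j T j i * n j)); rewrite -lc_comp.
have Ln k : exists m, (forall j, ((p ^ k)%:Z %| m j)%Z) /\ L (fun j => n j - m j).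
  elim: k => [|k [m [pm Lm]]].
    by exists n; split=> j; rewrite ?subrr ?dvdz0 // expn0 dvd1z.
  exists (fun k => - \sum_j m j * M j k); split=> j.
    rewrite rpredN; apply: rpred_sum => i _; rewrite expnSr PoszM.
    by apply: dvdz_mul; [apply: pm | apply: TS].
  rewrite opprK.
  have -> : n j + \sum_i m i * M i j =
      (n j + \sum_i n i * M i j) - \sum_i (n i - m i) * M i j.
    by rewrite -addrA -sumrB; congr (_ + _); apply: eq_bigr => i _; ring.
  exact: rpredB (LTS n n0 j) (LM _ Lm j).
move=> j; have [m [pm Lm]] := Ln (b j).
by rewrite -[n j](subrK (m j)); apply: rpredD (Lm j) (pm j).
Qed.

(** The action of the prime field by representatives, a module action on the elements killed by
    [p]. *)
Definition sc (v : V) (a : 'F_p) : V := v *+ (a : nat).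

Lemma Fp_natK (a : 'F_p) : (a : nat)%:R = a. Proof. exact: natr_Zp. Qed.

Lemma sc_int v z (a : 'F_p) : v *+ p = 0 -> z%:~R = a -> v *~ z = sc v a.
Proof.
move=> vp za; apply/eqP; rewrite /sc pmulrn -subr_eq0 -mulrzBr.
have /dvdzP[q ->] : (p %| z - (a : nat)%:Z)%Z by rewrite dvdz_Fp rmorphB /= za -pmulrn Fp_natK subrr.
by rewrite mulrC mulrzA -pmulrn vp mul0rz.
Qed.

Lemma scD v a b : v *+ p = 0 -> sc v (a + b) = sc v a + sc v b.
Proof.
move=> vp; have := @sc_int v ((a : nat)%:Z + (b : nat)%:Z) (a + b) vp.
by rewrite !mulrzDr -!pmulrn !Fp_natK => <-.
Qed.

Lemma scM v a b : v *+ p = 0 -> sc v (a * b) = sc (sc v a) b.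
Proof.
move=> vp; have := @sc_int v ((a : nat)%:Z * (b : nat)%:Z) (a * b) vp.
by rewrite [v *~ _]mulrzA intrM -!pmulrn !Fp_natK => <-.
Qed.

Lemma sc_sumr (I : finType) v (f : I -> 'F_p) :
  v *+ p = 0 -> sc v (\sum_i f i) = \sum_i sc v (f i).
Proof. by move=> vp; apply: (big_morph (sc v)) => // a b; apply: scD. Qed.

Lemma sc_suml (I : finType) (v : I -> V) a : sc (\sum_i v i) a = \sum_i sc (v i) a.
Proof. by rewrite /sc sumrMnl. Qed.

Lemma scBl u v a : sc (u - v) a = sc u a - sc v a.
Proof. exact: mulrnBl. Qed.

(** The hypothesis makes [M] of square zero, so [1 - M] is an exact inverse of [1 + M]. *)
Lemma basis_shear (I : finType) a (x : I -> V) (M : I -> I -> int) :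
  is_basis a x -> (forall i j k, M i j * M j k = 0) ->
  (forall i j, ((p ^ a j)%:Z %| (p ^ a i)%:Z * M i j)%Z) ->
  is_basis a (fun i => x i + lc x (M i)).
Proof.
move=> bx MM Ma; have [a0 _ _ _] := bx.
have delta i (f : I -> int) : \sum_j (i == j)%:R * f j = f i.
  by rewrite -[RHS](sum_delta i); apply: eq_bigr => j _; rewrite eq_sym.
have deltar i (f : I -> int) : \sum_j f j * (j == i)%:R = f i.
  by rewrite -[RHS](sum_delta i); apply: eq_bigr => j _; rewrite mulrC.
have P1 (u v : int) i k : u + v = 0 ->
    \sum_j ((i == j)%:R + u * M i j) * ((j == k)%:R + v * M j k) - (i == k)%:R = 0.
  move=> uv; under eq_bigr do rewrite mulrDl !mulrDr.
  rewrite !big_split /= delta deltar (delta i (fun j => v * M j k)) [X in _ + (_ + X)]big1 => [|j _].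
    by rewrite (_ : v = - u); [ring | apply/eqP; rewrite -addr_eq0 addrC uv].
  by rewrite mulrACA MM mulr0.
have := @basis_change I I a x a (fun i j => (i == j)%:R + 1 * M i j)
  (fun i j => (i == j)%:R + (-1) * M i j) bx a0.
have <- : (fun i => x i + lc x (M i)) = fun i => lc x (fun j => (i == j)%:R + 1 * M i j).
  apply: functional_extensionality => i; rewrite -lcD; congr (_ + _).
    rewrite /lc (bigD1 i) //= eqxx big1 ?addr0 // => j /negPf; rewrite eq_sym => ->.
    by rewrite mulr0z.
  by congr lc; apply: functional_extensionality => j; rewrite mul1r.
apply.
- by move=> i j; rewrite mul1r mulrDr rpredD //; case: (i =P j) => [->|_]; rewrite ?mulr0 ?mulr1 ?dvdz0.
- move=> i j; rewrite mulrDr rpredD //; last by rewrite mulrCA dvdz_mull.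
  by case: (i =P j) => [->|_]; rewrite ?mulr0 ?mulr1 ?dvdz0.
- by move=> i k; rewrite P1 ?dvdz0.
by move=> i k; rewrite P1 ?dvdz0.
Qed.

Variable D : {additive V -> V}.
Hypothesis pD : forall v, D v *+ p = 0.

Definition soc (I : finType) (a : I -> nat) (x : I -> V) i := x i *+ p ^ (a i).-1.

Definition realized : mxpred 'F_p := fun I r c d => r = c /\
  exists x : I -> V, is_basis r x /\ forall i, D (x i) = \sum_j sc (soc r x j) (d i j).

Lemma soc_p (I : finType) a (x : I -> V) i : is_basis a x -> soc a x i *+ p = 0.
Proof. by case=> a0 ax _ _; rewrite /soc -mulrnA -expnSr prednK. Qed.

Lemma basis_kill (I : finType) (a : I -> nat) x i e :
  is_basis a x -> (a i <= e)%N -> x i *+ p ^ e = 0.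
Proof. by case=> _ ax _ _ ae; rewrite -(subnKC ae) expnD mulrnA ax mul0rn. Qed.

Lemma mulrznAC (v : V) z n : v *~ z *+ n = v *+ n *~ z.
Proof. by rewrite !pmulrn -!mulrzA mulrC. Qed.

Lemma D_pmul v z : (p %| z)%Z -> D (v *~ z) = 0.
Proof. by case/dvdzP => q ->; rewrite raddfMz mulrC mulrzA -pmulrn pD mul0rz. Qed.

Lemma realized_closed : closed realized.
Proof.
have lc1 (I : finType) (x : I -> V) k l u i :
    lc x (fun j => ((i == k) && (j == l))%:R * u) = if i == k then x l *~ u else 0.
  rewrite /lc; case: (i =P k) => _ /=; last by rewrite big1 // => j _; rewrite mul0r mulr0z.
  rewrite (bigD1 l) //= eqxx mul1r big1 ?addr0 // => j /negPf->.
  by rewrite mul0r mulr0z.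
split.
- by move=> I r c d [-> _].
(* Row operation: [x k] becomes [x k + a x l]. The socle elements do not change, because [x l] has
   the smaller order. *)
- move=> I r _ d k l a [<- [x [bx Dx]]] lk; split=> //.
  have kl : k != l by apply: contraTneq lk => ->; rewrite ltnn.
  pose M i j : int := ((i == k) && (j == l))%:R * (a : nat)%:Z.
  have bx' : is_basis r (fun i => x i + lc x (M i)).
    apply: basis_shear => // [i j u|i j]; rewrite /M.
      case: (j =P l) => [->|_]; last by rewrite andbF !mul0r.
      by rewrite [l == k]eq_sym (negPf kl) mul0r mulr0.
    case: (i =P k) => [->|_] /=; last by rewrite mul0r mulr0 dvdz0.
    case: (j =P l) => [->|_] /=; last by rewrite mul0r mulr0 dvdz0.
    by rewrite dvdz_mulr // dvdzE dvdn_exp2l // ltnW.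
  exists (fun i => x i + lc x (M i)); split=> // i.
  have [r0 rx _ _] := bx.
  have -> : soc r (fun i => x i + lc x (M i)) = soc r x.
    apply: functional_extensionality => j; rewrite /soc mulrnDl lc1.
    case: (j =P k) => [->|_]; last by rewrite mul0rn addr0.
    rewrite mulrznAC (basis_kill bx) ?mul0rz ?addr0 //.
    by rewrite -ltnS prednK.
  rewrite raddfD /= lc1 Dx; under [RHS]eq_bigr do rewrite scD ?(soc_p _ bx) //.
  rewrite big_split /=; congr (_ + _).
  case: (i =P k) => _; last first.
    by rewrite raddf0 big1 // => j _; rewrite !mul0r /sc mulr0n.
  rewrite raddfMz Dx mulrz_suml; apply: eq_bigr => j _.
  by rewrite mul1r mulrC scM ?(soc_p _ bx) // -pmulrn.
(* Column operation: [x l] loses [a p ^ (r k - r l) x k]. This is a multiple of [p], so [D] does not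
   see it, but the socle element at [l] loses [a] times the one at [k]; in terms of the new
   elements, column [k] gains [a] times column [l]. *)
- move=> I r _ d k l a [<- [x [bx Dx]]] lk; split=> //.
  have kl : l != k by apply: contraTneq lk => ->; rewrite ltnn.
  pose u : int := - ((p ^ (r k - r l))%:Z * (a : nat)%:Z).
  pose M i j : int := ((i == l) && (j == k))%:R * u.
  have bx' : is_basis r (fun i => x i + lc x (M i)).
    apply: basis_shear => // [i j w|i j]; rewrite /M.
      case: (j =P k) => [->|_]; last by rewrite andbF !mul0r.
      by rewrite [k == l]eq_sym (negPf kl) mul0r mulr0.
    case: (i =P l) => [->|_] /=; last by rewrite mul0r mulr0 dvdz0.
    case: (j =P k) => [->|_] /=; last by rewrite mul0r mulr0 dvdz0.
    have -> : (p ^ r k)%:Z = (p ^ r l)%:Z * (p ^ (r k - r l))%:Z.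
      by rewrite -PoszM -expnD subnKC // ltnW.
    by rewrite mul1r mulrN rpredN mulrA dvdz_mulr.
  exists (fun i => x i + lc x (M i)); split=> // i.
  have [r0 rx _ _] := bx.
  have pu : (p %| u)%Z.
    by rewrite rpredN dvdz_mulr // dvdzE dvdn_exp // subn_gt0.
  have socE j : soc r (fun i => x i + lc x (M i)) j =
      if j == l then soc r x l - sc (soc r x k) a else soc r x j.
    rewrite /soc mulrnDl lc1; case: (j =P l) => [->|_]; last by rewrite mul0rn addr0.
    congr (_ + _); rewrite mulrNz mulNrn mulrznAC mulrzA -!pmulrn -(mulrnA (x k)) -expnD.
    by congr (- (_ *+ _ ^ _ *+ _)); have := r0 l; lia.
  have -> : D (x i + lc x (M i)) = D (x i).
    rewrite raddfD /= lc1; case: eqP => _; last by rewrite raddf0 addr0.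
    by rewrite D_pmul // addr0.
  have skp := soc_p k bx.
  rewrite Dx (bigD1 l) //= [in RHS](bigD1 l) //= socE eqxx (negPf kl) !mul0r addr0.
  have lk' : k != l by rewrite eq_sym.
  rewrite (bigD1 k) //= [in RHS](bigD1 k) //= socE (negPf lk').
  rewrite eqxx mul1r scD // scM // scBl.
  have <- : \sum_(j | (j != l) && (j != k)) sc (soc r x j) (d i j) =
    \sum_(j | (j != l) && (j != k)) sc (soc r (fun i => x i + lc x (M i)) j)
      (d i j + (j == k)%:R * a * d i l).
    by apply: eq_bigr => j /andP[jl jk]; rewrite socE (negPf jl) (negPf jk) !mul0r addr0.
  rewrite -addrA; congr (_ + _); rewrite addrA; congr (_ + _).
  by rewrite addrCA addNr addr0.
(* Base change within classes: only elements of equal order are mixed, so the socle elements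
   transform by the same matrix [P]. *)
move=> I J r _ d r' c' e P P' [<- [x [bx Dx]]] PP' P'P Pc P'c Pde.
have Pex j : exists i, P j i != 0.
    apply/existsP; apply: contraT => /existsPn P0.
    have := congr1 (fun h => h j j) PP'; rewrite /fone eqxx /fmul big1 => [/esym/eqP|i _].
      by rewrite oner_eq0.
    by have := P0 i; rewrite negbK => /eqP->; rewrite mul0r.
have cc : r' = c'.
  by apply: functional_extensionality => j; have [i /Pc[-> ->]] := Pex j.
have Pr j i : P j i != 0 -> r' j = r i by move=> /Pc[].
have P'r i j : P' i j != 0 -> r i = r' j by rewrite cc => /P'c[].
have [r0 rx _ _] := bx.
split=> //; pose T j i : int := (P j i : nat)%:Z; pose S i j : int := (P' i j : nat)%:Z.
have lift (X Y Z : finType) (A : X -> Y -> 'F_p) (B : Y -> Z -> 'F_p) i k (w : bool) :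
    fmul A B i k = w%:R -> (p %| \sum_j (A i j : nat)%:Z * (B j k : nat)%:Z - w%:R)%Z.
  have -> : (w%:R : int) = (w : nat)%:Z by rewrite natz.
  move=> ABE; rewrite dvdz_Fp intrB subr_eq0 rmorph_sum /= -pmulrn -ABE.
  by apply/eqP/eq_bigr => j _; rewrite intrM -!pmulrn !Fp_natK.
have bx' : is_basis r' (fun j => lc x (T j)).
  apply: (basis_change (S := S) bx).
  - by move=> j; have [i /Pr->] := Pex j.
  - move=> j i; rewrite /T; have [->|/Pr->] := eqVneq (P j i) 0; first by rewrite mulr0 dvdz0.
    exact: dvdz_mulr.
  - move=> i j; rewrite /S; have [->|/P'r->] := eqVneq (P' i j) 0; first by rewrite mulr0 dvdz0.
    exact: dvdz_mulr.
  - by move=> j k; apply: lift; rewrite PP'.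
  by move=> i k; apply: lift; rewrite P'P.
exists (fun j => lc x (T j)); split=> // j.
have socE k : soc r' (fun j => lc x (T j)) k = \sum_i sc (soc r x i) (P k i).
  rewrite /soc /lc -sumrMnl; apply: eq_bigr => i _.
  rewrite mulrznAC /T -pmulrn; have [->|/Pr->] := eqVneq (P k i) 0; first by rewrite !mulr0n.
  by [].
have -> : D (lc x (T j)) = \sum_k sc (soc r x k) (fmul P d j k).
  rewrite /lc raddf_sum.
  transitivity (\sum_i \sum_k sc (soc r x k) (P j i * d i k)).
    apply: eq_bigr => i _; rewrite raddfMz Dx /T -pmulrn -[LHS]/(sc _ _) sc_suml.
    by apply: eq_bigr => k _; rewrite mulrC scM // (soc_p _ bx).
  by rewrite exchange_big; apply: eq_bigr => k _; rewrite sc_sumr // (soc_p _ bx).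
rewrite Pde; under [RHS]eq_bigr do rewrite socE sc_suml.
rewrite exchange_big; apply: eq_bigr => k _ /=.
rewrite sc_sumr ?(soc_p _ bx) //; apply: eq_bigr => l _.
by rewrite mulrC scM // (soc_p _ bx).
Qed.

End Realize.

(** * The endomorphism D *)

Section Torsion.
Variables (V : zmodType) (p : nat) (D : {additive V -> V}).
Hypothesis p_pr : prime p.

Lemma iterD_add n u v : iter n D (u + v) = iter n D u + iter n D v.
Proof. by elim: n => //= n ->; rewrite raddfD. Qed.

Lemma iterD_mul n v k : iter n D (v *+ k) = iter n D v *+ k.
Proof. by elim: n => //= n ->; rewrite raddfMn. Qed.

Lemma iter_1D n v :
  iter n (fun v => v + D v) v = \sum_(i < n.+1) iter i D v *+ 'C(n, i).
Proof.
elim: n v => [|n IHn] v; first by rewrite big_ord_recl big_ord0 addr0.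
rewrite iterSr IHn; under eq_bigr do rewrite iterD_add mulrnDl.
rewrite big_split /=.
have -> : \sum_(i < n.+1) iter i D v *+ 'C(n, i) =
    v + \sum_(i < n.+1) iter i.+1 D v *+ 'C(n, i.+1).
  rewrite [in RHS]big_ord_recr /= (bin_small (ltnSn n)) mulr0n addr0.
  by rewrite big_ord_recl bin0.
rewrite [RHS]big_ord_recl bin0 /= -addrA -big_split /=; congr (_ + _).
by apply: eq_bigr => i _; rewrite add0n /bump /= binS mulrnDr -iterSr.
Qed.

(* Since [D ^ p = 0], expanding [(1 + D) ^ p = 1] gives [p D u = 0] with [u]
   unipotent; the cancellation of [u] is a descending induction. *)
Lemma torsion_of_unipotent :
  (forall v, iter p (fun v => v + D v) v = v) -> (forall v, iter p D v = 0) ->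
  forall v, D v *+ p = 0.
Proof.
move=> sp Dp.
have Dz k v : iter (p + k) D v = 0.
  by rewrite addnC iterD Dp; elim: k => //= k ->; rewrite raddf0.
suff H k : (k < p)%N -> forall v, iter (p - k) D v *+ p = 0.
  move=> v; have p0 := prime_gt0 p_pr; have := H p.-1.
  by rewrite (_ : p - p.-1 = 1)%N; [apply; lia | lia].
elim: k => [|k IHk] kp v; first by rewrite subn0 Dp mul0rn.
set j := (p - k.+1)%N; have {}IHk w : iter j.+1 D w *+ p = 0.
  by rewrite (_ : j.+1 = p - k)%N ?IHk //; lia.
have j0 : (0 < j)%N by lia.
have := sp (iter j.-1 D v); rewrite iter_1D big_ord_recl /= bin0 => /(canRL (addKr _)).
rewrite addNr; have -> : \sum_(i < p) D (iter (0 + i) D (iter j.-1 D v)) *+ 'C(p, bump 0 i) =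
   iter j D v *+ p.
  have p1 := prime_gt1 p_pr.
  have -> : iter j D v = D (iter j.-1 D v) by rewrite -iterS prednK.
  rewrite (bigD1 (Ordinal (ltnW p1))) //= bin1 big1 ?addr0 // => i i0.
  rewrite add0n -iterD -iterS; have {}i0 : (0 < i)%N by rewrite lt0n; apply: contra i0.
  (* The last binomial term contains at least the [p]-th iterate of [D]; the middle ones carry a
     factor [p] and vanish by the induction hypothesis. *)
  have [ip|ip] := eqVneq (bump 0 i) p.
    rewrite ip binn mulr1n (_ : (i + j.-1).+1 = p + (i + j - p))%N ?Dz //.
    by move: ip; rewrite /bump /=; lia.
  have /dvdnP[q ->] : (p %| 'C(p, bump 0 i))%N.
    by apply: prime_dvd_bin => //; move: ip (ltn_ord i); rewrite /bump /=; lia.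
  rewrite mulnC mulrnA (_ : (i + j.-1).+1 = j.+1 + i.-1)%N; last by lia.
  by rewrite iterD IHk mul0rn.
by [].
Qed.

End Torsion.

Lemma least_nat (P : nat -> Prop) n : P n -> exists t, P t /\ forall k, (k < t)%N -> ~ P k.
Proof.
elim/ltn_ind: n => n IHn Pn.
have [[k [kn Pk]]|H] := classic (exists k, (k < n)%N /\ P k); first exact: IHn kn Pk.
by exists n; split=> // k kn Pk; apply: H; exists k.
Qed.

(** * Orders of the basis elements along a chain *)

Section Split.
Variables (V : zmodType) (p : nat) (D : {additive V -> V}).
Hypotheses (p_pr : prime p) (pD : forall v, D v *+ p = 0).
Hypothesis D_nil : forall v, iter p D v = 0.

Definition divp (v : V) := exists u, v = u *+ p.

Lemma divpD u v : divp u -> divp v -> divp (u + v).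
Proof. by case=> a -> [b ->]; exists (a + b); rewrite mulrnDl. Qed.

Lemma divpN u : divp u -> divp (- u).
Proof. by case=> a ->; exists (- a); rewrite mulNrn. Qed.

Lemma divpMn u n : divp u -> divp (u *+ n).
Proof. by case=> a ->; exists (a *+ n); rewrite mulrnAC. Qed.

Lemma divp0 : divp 0. Proof. by exists 0; rewrite mul0rn. Qed.

Lemma divp_sum (I : Type) (s : seq I) (P : pred I) (f : I -> V) :
  (forall i, P i -> divp (f i)) -> divp (\sum_(i <- s | P i) f i).
Proof. by move=> H; elim/big_rec: _ => [|i v Pi]; [exact: divp0 | apply/divpD/H]. Qed.

Lemma divp_iterD n v : divp v -> divp (iter n D v).
Proof. by case=> u ->; exists (iter n D u); rewrite iterD_mul. Qed.

Section Basis.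
Variables (I : finType) (a : I -> nat) (x : I -> V).
Hypothesis bx : is_basis p a x.

Lemma lc_delta i z : lc x (fun j => (j == i)%:R * z) = x i *~ z.
Proof.
rewrite /lc (bigD1 i) //= eqxx mul1r big1 ?addr0 // => j /negPf->.
by rewrite mul0r mulr0z.
Qed.

Lemma not_divp_basis i : a i = 1%N -> ~ divp (x i).
Proof.
move=> ai [u]; have [_ _ span indep] := bx; have [n ->] := span u.
rewrite pmulrn lcM -[x i]mulr1z -lc_delta => /eqP; rewrite -subr_eq0 -mulrN1z lcM lcD.
move=> /eqP/indep/(_ i); rewrite ai eqxx mul1r mulrN1 expn1 => H.
have := rpredD H (dvdz_mull (n i) (dvdzz p)).
by rewrite subrK dvdzE /= dvdn1 => /eqP p1; move: p_pr; rewrite p1.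
Qed.

Lemma soc_neq0 i : soc p a x i != 0.
Proof.
have [a0 _ _ indep] := bx; apply/eqP => s0.
have := indep (fun j => (j == i)%:R * (p ^ (a i).-1)%:Z); rewrite lc_delta -pmulrn => /(_ s0 i).
rewrite eqxx mul1r dvdzE /= dvdn_Pexp2l ?prime_gt1 //.
by move: (a0 i); lia.
Qed.

Lemma soc_p' i : soc p a x i *+ p = 0. Proof. exact: soc_p bx. Qed.

Lemma soc_divp i : (1 < a i)%N -> divp (soc p a x i).
Proof.
move=> ai; exists (x i *+ p ^ (a i).-2).
by rewrite -mulrnA -expnSr prednK //; lia.
Qed.

Lemma soc1 i : a i = 1%N -> soc p a x i = x i.
Proof. by rewrite /soc => ->. Qed.

(** As [p D = 0], the coefficient of [x j] in [D (x i)] is a multiple of [p ^ (a j).-1]; the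
    quotient modulo [p] is the entry of the matrix. *)
Lemma realized_init : exists d, @realized V p D I a a d.
Proof.
have [a0 _ span indep] := bx.
suff /fin_all_exists[d dP] : forall i, exists di : I -> 'F_p,
    D (x i) = \sum_j sc (soc p a x j) (di j) by exists d; split=> //; exists x.
move=> i; have [n Dn] := span (D (x i)).
exists (fun j => (n j %/ (p ^ (a j).-1)%N)%Z%:~R); rewrite Dn; apply: eq_bigr => j _.
have /indep/(_ j) : lc x (fun j => n j * p) = 0 by rewrite -lcM -Dn -pmulrn pD.
rewrite -{1}(prednK (a0 j)) expnSr PoszM dvdz_mul2r ?eqz_nat -?lt0n ?prime_gt0 // => jn.
rewrite -(sc_int p_pr (soc_p' j) erefl) /soc -{1}(divzK jn) mulrC mulrzA -pmulrn //.
Qed.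

Lemma uniq_flatten_mem (T : eqType) (cs : seq (seq T)) c :
  uniq (flatten cs) -> c \in cs -> uniq c.
Proof.
move=> + cin; case/splitPr: cin => s1 s2.
by rewrite flatten_cat cat_uniq /= cat_uniq => /and3P[_ _ /andP[]].
Qed.

Section Chain.
Variables (d : I -> I -> 'F_p) (cs : seq (seq I)) (c : seq I) (i0 : I).
Hypothesis Dx : forall i, D (x i) = \sum_j sc (soc p a x j) (d i j).
Hypothesis dcs : chain_form d cs.
Hypothesis c_in : c \in cs.
Hypothesis D_torsion : forall v, v *+ p = 0 -> ~ divp v -> D v = 0 \/ ~ divp (D v).

Local Notation y m := (x (nth i0 c m)).
Local Notation b m := (a (nth i0 c m)).

Lemma chain_succ m : (m.+1 < size c)%N -> D (y m) = soc p a x (nth i0 c m.+1).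
Proof.
move=> mc; have [_ _ /(_ _ c_in)[_ /(sortedP i0)/(_ m mc)/linkP cl _]] := dcs.
rewrite Dx (bigD1 (nth i0 c m.+1)) //= cl eqxx big1 => [|j /negPf jm].
  by rewrite addr0 /sc val_Fp_nat // modn_small ?prime_gt1.
by rewrite cl jm /sc mulr0n.
Qed.

(** A socle element at an exponent above 1 is a multiple of [p], so only the members of order [p]
    count modulo [p]. *)
Lemma chain_last : exists2 u, divp u &
  D (y (size c).-1) = \sum_(m < size c | b m == 1%N) sc (y m) (d (nth i0 c (size c).-1) (nth i0 c m)) + u.
Proof.
have [ucs _ /(_ _ c_in)[c0 _ sup]] := dcs; have uc := uniq_flatten_mem ucs c_in.
have k0 : (0 < size c)%N by case: (c) c0.
have lc_in : nth i0 c (size c).-1 \in c by rewrite mem_nth // prednK.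
exists (\sum_(m < size c | b m != 1%N) sc (soc p a x (nth i0 c m))
    (d (nth i0 c (size c).-1) (nth i0 c m))).
  apply: divp_sum => m bm; apply/divpMn/soc_divp.
  by have [a0 _ _ _] := bx; move: (a0 (nth i0 c m)) bm; lia.
rewrite Dx (bigID (mem c)) /= [X in _ + X]big1 ?addr0 => [|j jc]; last first.
  by rewrite sup // /sc mulr0n.
rewrite -big_uniq //= (big_nth i0) big_mkord (bigID (fun m : 'I__ => b m == 1%N)) /=.
by congr (_ + _); apply: eq_bigr => m /eqP/soc1->.
Qed.

(** A basis element of order [p] is not a multiple of [p]. If it has a successor, its image is a
    nonzero socle element, which by [D_torsion] is not a multiple of [p] either, so the successor
    has order [p] too. Nilpotency keeps the members of order [p] out of the last image, and
    [D_torsion] then makes that image zero. *)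
Lemma chain_split : exists k, [/\ (k <= size c)%N,
    forall m, (m < k)%N -> (1 < b m)%N,
    forall m, (k <= m < size c)%N -> b m = 1%N
  & (k < size c)%N -> D (y (size c).-1) = 0].
Proof.
have [a0 _ _ _] := bx; have [ucs _ /(_ _ c_in)[c0 _ _]] := dcs.
set k := find (fun i => a i == 1%N) c.
have lo m : (m < k)%N -> (1 < b m)%N.
  by move=> mk; have := before_find i0 mk; have := a0 (nth i0 c m); lia.
have hi m : (k <= m < size c)%N -> b m = 1%N.
  case/andP; elim: m => [|m IHm] km mc.
    apply/eqP; rewrite leqn0 in km.
    by have := @nth_find _ i0 (fun i => a i == 1%N) c; rewrite has_find -/k (eqP km); apply.
  have [km1|km1] := eqVneq k m.+1.
    apply/eqP; have := @nth_find _ i0 (fun i => a i == 1%N) c.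
    by rewrite has_find -/k km1; apply.
  have {IHm}bm : b m = 1%N by apply: IHm; lia.
  have := chain_succ mc => Dy.
  have ym : y m *+ p = 0 by have := soc_p' (nth i0 c m); rewrite soc1.
  have [D0|] := D_torsion ym (not_divp_basis bm).
    by have := soc_neq0 (nth i0 c m.+1); rewrite -Dy D0 eqxx.
  rewrite Dy => ns; apply/eqP; rewrite eqn_leq a0 andbT leqNgt.
  by apply/negP => /soc_divp.
exists k; split=> //; first exact: find_size.
move=> kc; set n := (size c).-1; pose w := y k; pose s := (size c - k)%N.
have wi i : (i < s)%N -> y (k + i)%N = iter i D w.
  elim: i => [|i IHi] is_; first by rewrite addn0.
  rewrite /= -IHi; last by lia.
  by rewrite chain_succ ?addnS ?soc1 ?hi //; rewrite /s in is_; lia.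
have wp i : iter i D w *+ p = 0.
  by rewrite -iterD_mul /w; have := soc_p' (nth i0 c k); rewrite soc1 ?hi ?leqnn // => ->;
    elim: i => //= i ->; rewrite raddf0.
have nw i : (i < s)%N -> ~ divp (iter i D w).
  by move=> si; rewrite -wi //; apply/not_divp_basis/hi; rewrite /s in si; lia.
have [u du Dn] := chain_last.
pose be i := d (nth i0 c n) (nth i0 c (k + i)).
have {}Dn : D (y n) = \sum_(i < s) sc (iter i D w) (be i) + u.
  rewrite Dn; congr (_ + _).
  rewrite -(big_mkord (fun m => b m == 1%N) (fun m => sc (y m) (d (nth i0 c n) (nth i0 c m)))).
  rewrite (big_cat_nat (leq0n k) (ltnW kc)) /= big_nat_cond big1 ?add0r => [|m]; last first.
    by case/andP=> /andP[_ /lo bm] bm1; rewrite (eqP bm1) in bm.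
  rewrite big_nat_cond -{1}[k]add0n big_addn big_mkord -/s.
  apply: eq_big => [m|m _].
    by have := hi (m + k)%N; have := ltn_ord m; rewrite /s; lia.
  by rewrite addnC wi.
have sn : iter s D w = D (y n).
  have s0 : (0 < s)%N by rewrite subn_gt0.
  rewrite -(prednK s0) /= -wi; last by lia.
  by congr (D (y _)); rewrite /s /n; lia.
(* From [t] on, all iterates of [D] on [w] are multiples of [p]; nilpotency provides such a [t]. *)
have [t [tdiv tmin]] : exists t, divp (iter t D w) /\ forall i, (i < t)%N -> ~ divp (iter i D w).
  by apply: (least_nat (n := p)); rewrite D_nil; apply: divp0.
have st : (s <= t)%N by rewrite leqNgt; apply/negP => /nw.
have tge i : (t <= i)%N -> divp (iter i D w).
  by move=> ti; rewrite -(subnK ti) iterD; apply: divp_iterD.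
have be0 i : (i < s)%N -> be i = 0.
  move=> is_; apply/eqP; apply: contraT => bi.
  have exl : exists i, (i < s)%N && (be i != 0) by exists i; rewrite is_.
  case: (ex_minnP exl) => l /andP[ls bl] lmin.
  (* Applying [D] another [j] times moves the least nonzero term to [iter t.-1 D w], while the later
     terms, [u] and the left side all become multiples of [p]. This contradicts the minimality of
     [t]. *)
  pose j := (t.-1 - l)%N.
  have sumE : iter j D (D (y n)) =
      \sum_(i < s) sc (iter (j + i) D w) (be i) + iter j D u.
    rewrite Dn iterD_add; congr (_ + _).
    rewrite (big_morph (iter j D) (iterD_add D j) (iter_fix _ (raddf0 D))).
    by apply: eq_bigr => m _; rewrite /sc iterD_mul iterD.
  have : divp (sc (iter t.-1 D w) (be l)).
    rewrite -[sc _ _](addrK (\sum_(i < s | i != l :> nat) sc (iter (j + i) D w) (be i) + iter j D u)).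
    apply: divpD; last first.
      apply/divpN/divpD; last exact: divp_iterD.
      apply: divp_sum => m ml; have [lm|lm] := ltnP l m.
        by apply/divpMn/tge; rewrite /j; lia.
      have -> : be m = 0.
        apply/eqP; apply: contraT => bm; have := lmin m; rewrite bm andbT => /(_ _).
        by have := ltn_ord m; lia.
      by rewrite /sc mulr0n; apply: divp0.
    have -> : sc (iter t.-1 D w) (be l) + (\sum_(i < s | i != l :> nat)
        sc (iter (j + i) D w) (be i) + iter j D u) = iter j D (D (y n)).
      rewrite sumE [in RHS](bigD1 (Ordinal ls)) //= addrA; congr (_ + _ + _).
      by rewrite /j subnK //; lia.
    by rewrite -sn -iterD; apply: tge; rewrite /j; lia.
  move=> /(divpMn ((be l)^-1 : nat)); rewrite -/(sc _ _) -scM // divff //.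
  rewrite -[1]/(1%:R) /sc val_Fp_nat // modn_small ?prime_gt1 // mulr1n.
  by move=> /tmin H; exfalso; apply: H; lia.
have yu : D (y n) = u.
  by rewrite Dn big1 ?add0r // => i _; rewrite be0 // /sc mulr0n.
have bn : b n = 1%N by apply: hi; rewrite /n; lia.
have yn : y n *+ p = 0 by have := soc_p' (nth i0 c n); rewrite soc1.
by have [|] := D_torsion yn (not_divp_basis bn); rewrite yu.
Qed.

End Chain.
End Basis.
End Split.

Local Close Scope ring_scope.

(** * Finite abelian groups as additive modules *)

(** The proof of commutativity is a parameter of the type, so that the module structure can be
    inferred from the type. *)
Definition zmod_of (gT : finGroupType) (H : {group gT}) of abelian H : Type := subg_of H.

Section ZmodOf.
Variables (gT : finGroupType) (H : {group gT}) (cHH : abelian H).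
Local Notation V := (zmod_of cHH).

HB.instance Definition _ := Finite.copy V (subg_of H).

Definition zval (v : V) : gT := sgval v.
Definition zinj (h : gT) : V := subg H h.

Definition zadd (u v : V) : V := zinj (zval u * zval v)%g.
Definition zopp (v : V) : V := zinj (zval v)^-1%g.
Definition zzero : V := zinj 1%g.

Lemma zval_in v : zval v \in H. Proof. exact: subgP. Qed.

Lemma zinjK h : h \in H -> zval (zinj h) = h. Proof. exact: subgK. Qed.

Lemma zval_inj : injective zval. Proof. exact: subg_inj. Qed.

Lemma zaddA : associative zadd.
Proof. by move=> u v w; apply: zval_inj; rewrite !zinjK ?groupM ?zval_in // mulgA. Qed.

Lemma zaddC : commutative zadd.
Proof.
move=> u v; apply: zval_inj; rewrite !zinjK ?groupM ?zval_in //.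
exact: (centsP cHH) (zval_in u) _ (zval_in v).
Qed.

Lemma zadd0 : left_id zzero zadd.
Proof. by move=> u; apply: zval_inj; rewrite !zinjK ?groupM ?zval_in ?group1 // mul1g. Qed.

Lemma zaddN : left_inverse zzero zopp zadd.
Proof.
by move=> u; apply: zval_inj; rewrite !zinjK ?groupM ?groupV ?zval_in ?group1 // mulVg.
Qed.

HB.instance Definition _ := GRing.isZmodule.Build V zaddA zaddC zadd0 zaddN.

Local Open Scope ring_scope.

Lemma zval0 : zval 0 = 1%g. Proof. exact: zinjK. Qed.

Lemma zvalD u v : zval (u + v) = (zval u * zval v)%g.
Proof. by rewrite zinjK ?groupM ?zval_in. Qed.

Lemma zvalMn v n : zval (v *+ n) = (zval v ^+ n)%g.
Proof. by elim: n => [|n IHn]; [exact: zval0 | rewrite mulrS zvalD IHn expgS]. Qed.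

Lemma zvalN v : zval (- v) = (zval v)^-1%g.
Proof. by rewrite zinjK ?groupV ?zval_in. Qed.

End ZmodOf.

Section Basis.
Variables (gT : finGroupType) (H : {group gT}) (cHH : abelian H) (p : nat).
Hypotheses (p_pr : prime p) (pH : (p.-group H)%g).
Local Notation V := (zmod_of cHH).
Local Open Scope ring_scope.

Lemma zval_sum (I : finType) (f : I -> V) :
  zval (\sum_i f i) = (\prod_i zval (f i))%g.
Proof. by apply: (big_morph (@zval _ _ cHH)) => [u v|]; [exact: zvalD | exact: zval0]. Qed.

Lemma zvalMz_cycle (v : V) z : zval (v *~ z) \in <[zval v]>%g.
Proof. by case: z => n; rewrite ?NegzE ?mulrNz ?zvalN ?groupV -pmulrn zvalMn mem_cycle. Qed.

Lemma dvdz_order (v : V) z : v *~ z = 0 -> (#[zval v]%g %| z)%Z.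
Proof.
suff H0 n : v *+ n = 0 -> (#[zval v]%g %| n)%N.
  case: z => n; first by rewrite -pmulrn => /H0.
  rewrite NegzE mulrNz -pmulrn => /eqP; rewrite oppr_eq0 => /eqP/H0.
  by rewrite dvdzE abszN.
by move=> vn; rewrite order_dvdn -zvalMn vn zval0.
Qed.

Lemma basis_exists : exists (I : finType) a (x : I -> V), is_basis p a x.
Proof.
have [b bH bt] := abelian_structure cHH.
pose X (i : 'I_(size b)) := tnth (in_tuple b) i.
have XH : \big[dprod/1%g]_(i < size b) <[X i]>%g = H.
  by rewrite -[RHS]bH (big_tnth _ _ b).
have Xin i : X i \in H.
  by rewrite -(bigdprodWY XH) mem_gen //; apply/bigcupP; exists i => //; apply: cycle_id.
have X1 i : (1 < #[X i]%g)%N.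
  have := abelian_type_gt1 H; rewrite -bt all_map => /allP; apply.
  exact: mem_tnth.
have XE i : #[X i]%g = (p ^ logn p #[X i]%g)%N.
  by rewrite -p_part part_pnat_id //; apply: mem_p_elt (Xin i).
pose x i : V := zinj cHH (X i).
have zx i : zval (x i) = X i by rewrite zinjK.
exists 'I_(size b), (fun i => logn p #[X i]%g), x; split.
- by move=> i; rewrite lt0n; apply: contraTneq (X1 i) => l0; rewrite XE l0.
- by move=> i; apply: zval_inj; rewrite zvalMn zx -XE expg_order zval0.
- move=> v; have [g [gX vg _]] := mem_bigdprod XH (zval_in v).
  have /fin_all_exists[n nP] : forall i, exists k, g i = (X i ^+ k)%g.
    by move=> i; have /cycleP := gX i isT.
  exists (fun i => n i); apply: zval_inj; rewrite vg zval_sum; apply: eq_bigr => i _.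
  by rewrite -pmulrn zvalMn zx.
move=> n n0 i; rewrite -XE -zx; apply: dvdz_order; apply: zval_inj.
have [g [gX _ gu]] := mem_bigdprod XH (group1 H).
rewrite zval0 (gu (fun i => zval (x i *~ n i))) //.
- by rewrite -(gu (fun=> 1%g)) // big1.
- by move=> j _; rewrite -zx zvalMz_cycle.
by rewrite -zval_sum -[X in zval X]/(lc x n) n0 zval0.
Qed.

Section Given.
Variables (I : finType) (a : I -> nat) (x : I -> V).
Hypothesis bx : is_basis p a x.

Lemma order_basis i : #[zval (x i)]%g = (p ^ a i)%N.
Proof.
have [_ ax _ indep] := bx; apply/eqP; rewrite eqn_dvd order_dvdn -zvalMn ax zval0 eqxx /=.
have := indep (fun j => (j == i)%:R * #[zval (x i)]%g%:Z).
rewrite lc_delta -pmulrn => /(_ _ i); rewrite eqxx mul1r; apply.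
by apply: zval_inj; rewrite zvalMn expg_order zval0.
Qed.

Definition span_of (s : seq I) := <<[set zval (x i) | i in s]>>%g.

Lemma zval_lc_in s n : (forall i, i \notin s -> x i *~ n i = 0) -> zval (lc x n) \in span_of s.
Proof.
move=> sn; rewrite zval_sum; apply: group_prod => i _.
have [si|/sn->] := boolP (i \in s); last by rewrite zval0 group1.
apply: (subsetP _ _ (zvalMz_cycle _ _)); rewrite cycle_subG mem_gen //.
exact: imset_f.
Qed.

Lemma span_ofP s h : h \in span_of s ->
  exists2 n, forall i, i \notin s -> n i = 0 & h = zval (lc x n).
Proof.
case/gen_prodgP => k [c cs ->].
apply: (big_ind (fun h => exists2 n : I -> int, forall i, i \notin s -> n i = 0 & h = zval (lc x n))).
- exists (fun=> 0) => //; rewrite /lc big1 ?zval0 // => i _; exact: mulr0z.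
- move=> _ _ [n n0 ->] [n' n0' ->]; exists (fun i => n i + n' i).
    by move=> i si; rewrite n0 ?n0' ?addr0.
  by rewrite -lcD zvalD.
move=> i _; have /imsetP[j js ->] := cs i.
exists (fun l => (l == j)%:R * 1); last by rewrite lc_delta.
by move=> l ls; case: eqP ls => [->|_ _]; rewrite ?js ?mul0r.
Qed.

Lemma span_of_sub s : span_of s \subset H.
Proof. by rewrite gen_subG; apply/subsetP => _ /imsetP[i _ ->]; apply: zval_in. Qed.

Lemma dprod_basis s : uniq s -> (\big[dprod/1]_(i <- s) <[zval (x i)]>)%g = span_of s.
Proof.
elim: s => [|i s IHs] /=.
  rewrite big_nil /span_of (_ : [set _ | _ in _] = set0) ?gen0 //.
  by apply/setP => h; rewrite inE; apply/imsetP => -[].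
case/andP=> is_ us; rewrite big_cons IHs //.
have cs : span_of s \subset 'C(<[zval (x i)]>)%g.
  by rewrite (sub_abelian_cent2 cHH) ?span_of_sub // cycle_subG zval_in.
rewrite dprodE //.
  rewrite -(cent_joinEr cs) joing_idl joing_idr /joing; congr <<_>>%g.
  apply/setP => h; rewrite !inE; apply/orP/imsetP => [[/eqP->|/imsetP[j js ->]]|[j]].
  - by exists i; rewrite ?inE ?eqxx.
  - by exists j; rewrite ?inE ?js ?orbT.
  by rewrite inE => /orP[/eqP->|js] ->; [left | right; apply: imset_f].
apply/trivgP/subsetP => h; rewrite inE => /andP[/cycleP[k ->] /span_ofP[n n0 hn]].
have [_ _ _ indep] := bx.
have := indep (fun j => (j == i)%:R * k%:Z + n j * -1).
rewrite -lcD lc_delta -(lcM x n) -pmulrn mulrN1z.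
have -> : x i *+ k = lc x n by apply: zval_inj; rewrite zvalMn hn.
rewrite subrr => /(_ erefl i); rewrite eqxx n0 // mul0r addr0 mul1r dvdzE /=.
by rewrite -order_basis order_dvdn inE.
Qed.

End Given.
End Basis.

(** * The commutator with [alpha] as an additive map *)

Section Commutator.
Variables (gT : finGroupType) (H : {group gT}) (cHH : abelian H) (alpha : gT).
Hypothesis nHa : alpha \in 'N(H)%g.
Local Notation V := (zmod_of cHH).
Local Open Scope ring_scope.

Definition zcomm of alpha \in 'N(H)%g : V -> V := fun v => zinj cHH [~ zval v, alpha]%g.
Local Notation D := (zcomm nHa).

Lemma zval_comm v : zval (D v) = [~ zval v, alpha]%g.
Proof. by rewrite zinjK // commgEl groupM ?groupV ?memJ_norm ?zval_in. Qed.

Lemma zval_addcomm v : zval (v + D v) = (zval v ^ alpha)%g.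
Proof. by rewrite zvalD zval_comm commgEl mulKVg. Qed.

(** From [[u v, alpha] = [u, alpha] ^ v [v, alpha]], where conjugation by [v] is trivial because [H]
    is abelian. *)
Lemma zcomm_additive : nmod_morphism D.
Proof.
split=> [|u v]; apply: zval_inj; rewrite ?zvalD !zval_comm ?zval0 ?comm1g //.
rewrite zvalD commMgJ conjgE.
have cH x y : x \in H -> y \in H -> (x * y = y * x)%g by move=> xH yH; apply: (centsP cHH).
by rewrite (cH [~ zval u, alpha]%g) ?mulKg -?zval_comm ?zval_in.
Qed.

HB.instance Definition _ := GRing.isNmodMorphism.Build V V D zcomm_additive.

Lemma iter_addcomm n v : zval (iter n (fun v => v + D v) v) = (zval v ^ (alpha ^+ n))%g.
Proof. by elim: n => [|n IHn]; rewrite ?conjg1 //= zval_addcomm IHn -conjgM expgSr. Qed.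

End Commutator.

(** * Reading off the four types *)

Section Types.
Variables (gT : finGroupType) (G H : {group gT}) (cHH : abelian H) (alpha : gT) (p : nat).
Hypotheses (nHa : alpha \in 'N(H)%g) (sHG : H \subset G).
Hypotheses (p_pr : prime p) (G_gen : (H * <[alpha]>)%g = G).
Local Notation V := (zmod_of cHH).
Local Notation D := (@zcomm _ _ cHH _ nHa).
Local Open Scope ring_scope.

Hypotheses (pD : forall v : V, D v *+ p = 0) (D_nil : forall v : V, iter p D v = 0).
Hypothesis D_torsion :
  forall v : V, v *+ p = 0 -> ~ divp p v -> D v = 0 \/ ~ divp p (D v).

Lemma zval_center (v : V) : D v = 0 -> zval v \in 'Z(G)%g.
Proof.
move=> Dv; rewrite inE (subsetP sHG) ?zval_in //= -G_gen centM inE.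
rewrite (subsetP cHH) ?zval_in //= cent_cycle; apply/cent1P/commgP.
by rewrite -(zval_comm nHa) Dv zval0.
Qed.

Section Chain.
Variables (I : finType) (a : I -> nat) (x : I -> V).
Hypothesis bx : is_basis p a x.
Variables (d : I -> I -> 'F_p) (cs : seq (seq I)) (c : seq I).
Hypothesis Dx : forall i, D (x i) = \sum_j sc (soc p a x j) (d i j).
Hypothesis dcs : chain_form d cs.
Hypothesis c_in : c \in cs.

Local Notation N := (span_of x c).

Lemma span_of_normal : (N <| G)%g.
Proof.
rewrite /normal (subset_trans (span_of_sub _ _)) //= -G_gen.
rewrite mul_subG //; first exact/cents_norm/(sub_abelian_cent2 cHH)/span_of_sub.
rewrite cycle_subG inE -genJ gen_subG; apply/subsetP => _ /imsetP[_ /imsetP[i ic ->] ->].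
rewrite -(zval_addcomm nHa) zvalD groupM //; first by apply/mem_gen/imset_f.
have [_ _ /(_ _ c_in)[_ _ sup]] := dcs.
rewrite Dx zval_sum group_prod // => j _.
have [jc|jc] := boolP (j \in c); last by rewrite sup // /sc mulr0n zval0 group1.
by rewrite /sc !zvalMn !groupX //; apply/mem_gen/imset_f.
Qed.

Lemma zval_soc i : zval (soc p a x i) = (zval (x i) ^+ (p ^ (a i).-1))%g.
Proof. by rewrite zvalMn. Qed.

(** The place [k] where the exponents drop to 1 decides: (2) or (4) if they never drop, (1) if they
    are 1 from the start, (3) otherwise. The predicates count from 1 and lists from 0, hence the
    shifted functions. *)
Lemma zval_chain_type :
  [\/ elementary_chain p G alpha N, cyclic_block p alpha N,
      mixed_chain p G alpha N | cyclic_chain p G alpha N].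
Proof.
have [ucs _ /(_ _ c_in)[c0 _ sup]] := dcs; have uc := uniq_flatten_mem ucs c_in.
have [i0 c0'] : exists i0, i0 \in c by case: (c) c0 => // i s _; exists i; rewrite mem_head.
have K0 : (0 < size c)%N by case: (c) c0.
have [a0 _ _ _] := bx.
have [k [kK lo hi lst]] := chain_split p_pr D_nil bx i0 Dx dcs c_in D_torsion.
have succ := chain_succ p_pr i0 Dx dcs c_in.
pose X m := zval (x (nth i0 c m)); pose b m := a (nth i0 c m).
have ordX m : #[X m]%g = (p ^ b m)%N by apply: order_basis.
have NE : (\big[dprod/1]_(0 <= m < size c) <[X m]>)%g = N.
  by rewrite -(dprod_basis bx uc) (big_nth i0).
have succX m : (m.+1 < size c)%N -> [~ X m, alpha]%g = (X m.+1 ^+ (p ^ (b m.+1).-1))%g.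
  by move=> mc; rewrite -(zval_comm nHa) succ // zval_soc.
have lstX : (k < size c)%N -> X (size c).-1 \in 'Z(G)%g.
  by move=> /lst; apply: zval_center.
have socZ m : (1 < b m)%N -> (X m ^+ (p ^ (b m).-1))%g \in 'Z(G)%g.
  move=> bm; rewrite -zval_soc; apply: zval_center.
  by have [u ->] := soc_divp p_pr x bm; rewrite raddfMn pD.
have [kE|kneK] := eqVneq k (size c).
  have Dl : [~ X (size c).-1, alpha]%g = zval (\sum_(m < size c)
      sc (soc p a x (nth i0 c m)) (d (nth i0 c (size c).-1) (nth i0 c m))).
    rewrite -(zval_comm nHa) Dx (bigID (mem c)) /= [X in _ + X]big1 ?addr0 => [|j jc].
      by rewrite -big_uniq //= (big_nth i0) big_mkord.
    by rewrite sup ?mem_nth ?prednK // /sc mulr0n.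
  have [K1|K1] := eqVneq (size c) 1%N.
    apply: Or42; exists (b 0%N), (X 0%N); split; first by apply/ltnW/lo; rewrite kE.
    - by rewrite -NE K1 big_nat1.
    - exact: ordX.
    exists (d (nth i0 c 0) (nth i0 c 0) : nat).
      by rewrite /= -ltnS prednK ?prime_gt0 // (leq_trans (ltn_ord _)) // Fp_cast.
    move: Dl; rewrite K1 big_ord_recl big_ord0 addr0 /= => ->.
    by rewrite /sc zvalMn zval_soc -expgM mulnC.
  apply: Or44; exists (size c), (fun m => b m.-1), (fun m => X m.-1).
  have K2 : (1 < size c)%N by rewrite ltn_neqAle eq_sym K1.
  split=> //.
  - by split=> // m /andP[m0 mK]; apply: lo; rewrite kE; case: (m) m0 mK.
  - by split=> [|m _]; [by rewrite big_add1 -NE | exact: ordX].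
  - move=> [|m] // /andP[_ mK]; have {}mK : (m.+1 < size c)%N by move: K0 mK; clear; lia.
    by rewrite /= succX ?socZ ?lo ?kE.
  rewrite Dl zval_sum group_prod // => m _; rewrite /sc zvalMn zval_soc groupX //.
  by apply: mem_gen; rewrite big_add1 big_mkord; apply/bigcupP; exists m; rewrite ?inE.
have kK' : (k < size c)%N by rewrite ltn_neqAle kneK.
have X1 m : (k <= m < size c)%N -> b m = 1%N /\ #[X m]%g = p.
  by move=> /hi bm; rewrite ordX /b bm.
have [k0|k0] := posnP k.
  apply: Or41; exists (size c), (fun m => X m.-1); split=> //.
  - by rewrite big_add1 -NE.
  - by case=> // m mK; have [] := X1 m; rewrite ?k0.
  - move=> [|m] // /andP[_ mK]; have {}mK : (m.+1 < size c)%N by move: K0 mK; clear; lia.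
    by rewrite /= succX //; have [|-> _] := X1 m.+1; rewrite ?k0 ?expg1.
  exact: lstX.
(* The shift in [k + m - 2] makes [y 1] the last member of order above [p], which is [x k]. *)
apply: Or43; exists k, (size c - k)%N, (fun m => b m.-1), (fun m => X m.-1), (fun m => X (k + m - 2)%N).
split=> //.
- split=> // [|[|m] // /andP[_ mk]]; first by rewrite subn_gt0.
  exact: lo.
- split=> [|m _|m /andP[m2 mK]].
  + rewrite -NE (big_cat_nat (leq0n k) kK) /=; congr (_ \x _)%g; first by rewrite big_add1.
    rewrite -[X in _ = \big[_/_]_(X <= _ < _) _]add0n big_addn !big_add1; apply: eq_bigr => m _.
    by congr <[X _]>%g; clear; lia.
  + exact: ordX.
  by have [|] := X1 (k + m - 2)%N; first by move: m2 mK kK' k0; clear; lia.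
- move=> [|m] // /andP[_ mK]; have {}mK : (m.+1 < k)%N by move: k0 mK; clear; lia.
  by rewrite /= succX ?socZ ?lo // (leq_trans mK).
split.
- by congr X; move: k0; clear; lia.
- move=> m /andP[m0 mK]; rewrite succX; last by move: k0 m0 mK kK'; clear; lia.
  have [|-> _] := X1 (k + m - 2).+1; first by move: k0 m0 mK kK'; clear; lia.
  by rewrite expg1; congr X; move: k0 m0; clear; lia.
rewrite (_ : k + (size c - k).+1 - 2 = (size c).-1)%N ?lstX //.
by move: k0 kK'; clear; lia.
Qed.

End Chain.
End Types.

Local Open Scope group_scope.

Theorem lemma1p7 (gT : finGroupType) (p n : nat) (G H : {group gT})
    (alpha : gT) :
  prime p ->
  2 <= n ->
  #|G| = (p ^ n)%N ->
  H \subset G ->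
  abelian H ->
  #|H| = (p ^ (n - 1))%N ->
  alpha \in G ->
  alpha \notin H ->
  alpha ^+ p \in H ->
  (forall h : gT, h \in nonpower_ptorsion p H ->
     [~ h, alpha] \in nonpower_ptorsion p H :|: [set 1]) ->
  'L_p.+1(G) = 1 ->
  exists (m : nat) (N : 'I_m -> {group gT}),
    \big[dprod/1]_(i < m) N i = H
    /\ (forall i : 'I_m,
          N i <| G
          /\ [\/ elementary_chain p G alpha (N i),
                 cyclic_block p alpha (N i),
                 mixed_chain p G alpha (N i)
               | cyclic_chain p G alpha (N i)]).
Proof.
move=> p_pr n2 cG sHG cHH cH aG naH apH hyp LG.
have pG : p.-group G by rewrite /pgroup cG pnatX pnat_id.
have maxH : maximal H G.
  apply: p_index_maximal => //; rewrite -divgS // cG cH -expnB ?prime_gt0 //; last by lia.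
  by rewrite (_ : (n - (n - 1) = 1)%N) ?expn1 //; lia.
have nHG : H <| G := p_maximal_normal pG maxH.
have nHa : alpha \in 'N(H) by apply: subsetP aG; apply: normal_norm.
have G_gen : H * <[alpha]> = G.
  by apply: mulg_normal_maximal; rewrite ?cycle_subG.
pose D := @zcomm _ _ cHH _ nHa.
have pN (v : zmod_of cHH) : (v *+ p ^ (n - 1) = 0)%R.
  by apply: zval_inj; rewrite zvalMn -cH zval0 expg_cardG ?zval_in.
(* The library counts from ['L_1(G) = G], so [iter k D v] lies in ['L_k.+1(G)], and ['L_p.+1(G)] is
   the term written [G_(p)] in the statement. *)
have D_nil (v : zmod_of cHH) : iter p D v = 0%R.
  apply: zval_inj; rewrite zval0; apply/set1P; rewrite -[[set 1]]LG.
  elim: (p) => [|k IHk]; first by rewrite lcn1 (subsetP sHG) ?zval_in.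
  by rewrite lcnSn iterS zval_comm mem_commg.
have D_unip (v : zmod_of cHH) : iter p (fun v => (v + D v)%R) v = v.
  apply: zval_inj; rewrite iter_addcomm conjgE.
  by rewrite ((centsP cHH) _ (zval_in v) _ apH) mulKg.
have pD := torsion_of_unipotent p_pr D_unip D_nil.
(* Additively, [H(p)] consists of the elements killed by [p] that are not multiples of [p]. *)
have D_tors (v : zmod_of cHH) : (v *+ p = 0)%R -> ~ divp p v -> D v = 0%R \/ ~ divp p (D v).
  move=> vp ndv; have : @zval _ _ cHH v \in nonpower_ptorsion p H.
    rewrite /nonpower_ptorsion !inE zval_in -zvalMn vp zval0 eqxx /=; apply/imsetP => -[h hH vE].
    by apply: ndv; exists (zinj cHH h); apply: zval_inj; rewrite zvalMn zinjK.
  move/hyp; rewrite -(zval_comm nHa) /nonpower_ptorsion !inE => /orP[/and3P[_ _ nd]|/eqP D0]; last first.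
    by left; apply: zval_inj; rewrite D0 zval0.
  right=> -[u Du]; case/negP: nd; rewrite -/(D v) Du zvalMn.
  exact: (imset_f (fun h => h ^+ p)) (zval_in u).
have pH : p.-group H := pgroupS sHG pG.
have [I0 [a0 [x0 bx0]]] := basis_exists cHH pH.
have [d0 R0] := realized_init p_pr pD bx0.
have [I [a [c [d [cs [[_ [x [bx Dx]]] dcs]]]]]] :=
  chain_form_exists (realized_closed p_pr pN pD) R0.
have [ucs mcs _] := dcs.
exists (size cs), (fun i => <<[set zval (x j) | j in nth [::] cs i]>>%G).
have dprodc c' : c' \in cs -> \big[dprod/1]_(i <- c') <[zval (x i)]> = span_of x c'.
  by move=> /(uniq_flatten_mem ucs)/(dprod_basis bx).
split=> [|i]; last first.
  have ci : nth [::] cs i \in cs by rewrite mem_nth.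
  split; first exact: (span_of_normal sHG G_gen Dx dcs ci).
  exact: (zval_chain_type sHG p_pr G_gen pD D_nil D_tors bx Dx dcs ci).
transitivity (\big[dprod/1]_(i <- flatten cs) <[zval (x i)]>).
  rewrite big_flatten (big_nth [::]) big_mkord; apply: eq_bigr => i _.
  by rewrite dprodc // mem_nth.
rewrite (dprod_basis bx ucs); apply/eqP; rewrite eqEsubset span_of_sub /=.
apply/subsetP => h hH; have [_ _ span _] := bx; have [m hm] := span (zinj cHH h).
rewrite -(zinjK cHH hH) hm; apply: zval_lc_in => i; by rewrite mcs.
Qed.
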